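(* Consider the optimization problem $$\min_{w_1,\dots,w_K}\ \sum_{k=1}^K \big(J_k(w_k)+R_k(w_k)\big)\quad\text{subject to}\quad \sum_{k\in\mathcal{C}_e}(B_{e,k}w_k-b_{e,k})=0,\quad e=1,\dots,E, \qquad (P)$$ and the matrices $\mathcal{B},\mathcal{U}_1,\Sigma$, the vector $b$, the functions $\mathcal{J},\mathcal{R}$ and the constants $\delta\ge\nu>0$ described in the context. Suppose the cost assumption, the sub-network assumption and the strong duality assumption stated in the context hold, and that the constant step-sizes $\mu_w>0$, $\mu_v>0$ satisfy $$\mu_w<\frac{1}{2\delta-\nu},\qquad \mu_v<\frac{\nu}{\lambda_{\max}(\mathcal{B}^{\mathsf T}\mathcal{B})}.$$ Let the sequences $(\mathsf{w}_i,\mathsf{y}_i,\mathsf{x}_i)$ be generated as follows: $\mathsf{w}_{-1},\mathsf{y}_{-1}$ are arbitrary, $\mathsf{w}_0=\mathrm{prox}_{\mu_w\mathcal{R}}\big(\mathsf{w}_{-1}-\mu_w\nabla\mathcal{J}(\mathsf{w}_{-1})-\mu_w\mathcal{B}^{\mathsf T}\mathsf{y}_{-1}\big)$, $\mathsf{y}_0=\mathsf{y}_{-1}+\mu_v(\mathcal{B}\mathsf{w}_0-b)$, $\mathsf{x}_0=0$, and for $i\ge 1$ \begin{align*} \mathsf{w}_i&=\mathrm{prox}_{\mu_w\mathcal{R}}\big(\mathsf{w}_{i-1}-\mu_w\nabla\mathcal{J}(\mathsf{w}_{i-1})-\mu_w\mathcal{B}^{\mathsf T}\mathsf{y}_{i-1}\big),\\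 \mathsf{x}_i&=\mathsf{x}_{i-1}-\tfrac{1}{\mu_v}\mathcal{U}_1^{\mathsf T}\big(\mathsf{y}_{i-1}+\mu_v(\mathcal{B}\mathsf{w}_i-b)+\mu_v\mathcal{U}_1\Sigma\mathsf{x}_{i-1}\big),\\ \mathsf{y}_i&=\mathsf{y}_{i-1}+\mu_v(\mathcal{B}\mathsf{w}_i-b)+\mu_v\mathcal{U}_1\Sigma\mathsf{x}_i. \end{align*} Then these recursions converge (the sequence $(\mathsf{w}_i,\mathsf{y}_i,\mathsf{x}_i)$ converges), and $\mathsf{w}_i$ converges to the optimal solution of $(P)$.
   Context: Setting. There are $K$ agents forming an undirected graph; $\mathcal{N}_k$ denotes the neighborhood of agent $k$, including $k$ itself. There are $E$ constraints; $\mathcal{C}_e\subseteq\{1,\dots,K\}$ is the nonempty set of agents involved in constraint $e$, $N_e=|\mathcal{C}_e|$. For $k\in\mathcal{C}_e$, $B_{e,k}\in\mathbb{R}^{S_e\times Q_k}$ and $b_{e,k}\in\mathbb{R}^{S_e}$. The variables are $w_k\in\mathbb{R}^{Q_k}$, stacked as $\mathsf{w}=\mathrm{col}\{w_k\}_{k=1}^K$. The functions are $J_k:\mathbb{R}^{Q_k}\to\mathbb{R}$ and $R_k:\mathbb{R}^{Q_k}\to\mathbb{R}\cup\{+\infty\}$; $\mathcal{J}(\mathsf{w})=\sum_kJ_k(w_k)$, $\mathcal{R}(\mathsf{w})=\sum_kR_k(w_k)$, so $\nabla\mathcal{J}(\mathsf{w})=\mathrm{col}\{\nabla J_k(w_k)\}_{k=1}^K$.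 Cost assumption. $\mathcal{J}$ is convex and differentiable with $\|\nabla\mathcal{J}(\mathsf{w})-\nabla\mathcal{J}(\mathsf{w}')\|\le\delta\|\mathsf{w}-\mathsf{w}'\|$ and $(\mathsf{w}-\mathsf{w}')^{\mathsf T}\nabla\mathcal{J}(\mathsf{w})\ge\mathcal{J}(\mathsf{w})-\mathcal{J}(\mathsf{w}')+\frac{\nu}{2}\|\mathsf{w}-\mathsf{w}'\|^2$ for all $\mathsf{w},\mathsf{w}'$, where $\delta\ge\nu>0$. Each $R_k$ is a proper closed convex function. Sub-network assumption. The graph is undirected and the subgraph induced on each $\mathcal{C}_e$ is connected. Strong duality assumption. With Lagrangian $\mathcal{L}(\mathsf{w},\{v^e\}_{e=1}^E)=\sum_{k}\big(J_k(w_k)+R_k(w_k)\big)+\sum_{e=1}^E(v^e)^{\mathsf T}\sum_{k\in\mathcal{C}_e}(B_{e,k}w_k-b_{e,k})$, $v^e\in\mathbb{R}^{S_e}$, the saddle point problem $\min_{\mathsf{w}}\max_{\{v^e\}}\mathcal{L}$ has a solution and strong duality holds. Combination matrices. For each $e$, $A_e=[a_{e,sk}]_{s,k\in\mathcal{C}_e}\in\mathbb{R}^{N_e\times N_e}$ is symmetric, doubly stochastic (nonnegative entries, rows and columns sum to one) and primitive (some power has all entries positive), with $a_{e,sk}=0$ if $s\notin\mathcal{N}_k\cap\mathcal{C}_e$. Put $\mathcal{A}=\mathrm{blkdiag}\{A_e\otimes I_{S_e}\}_{e=1}^E$, of size $N=\sum_eN_eS_e$. Write the eigendecomposition $\frac12(I_N-\mathcal{A})=\mathcal{U}_1\Sigma\mathcal{U}_1^{\mathsf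 T}$ where $\Sigma=\mathrm{diag}\{\lambda_1,\dots,\lambda_r\}$ contains the non-zero eigenvalues $\lambda_r\le\cdots\le\lambda_1$ of $\frac12(I_N-\mathcal{A})$ and $\mathcal{U}_1\in\mathbb{R}^{N\times r}$ has the corresponding orthonormal eigenvectors as columns ($\mathcal{U}_1^{\mathsf T}\mathcal{U}_1=I$). Stacked quantities. $\mathsf{y}\in\mathbb{R}^N$ is stacked as $\mathsf{y}=\mathrm{col}\{\mathsf{y}^e\}_{e=1}^E$, $\mathsf{y}^e=\mathrm{col}\{v^e_k\}_{k\in\mathcal{C}_e}$ with $v^e_k\in\mathbb{R}^{S_e}$; $\mathsf{x}\in\mathbb{R}^r$. $b=\mathrm{col}\{b_e\}_{e=1}^E$, $b_e=\mathrm{col}\{b_{e,k}\}_{k\in\mathcal{C}_e}$. $\mathcal{B}$ is the block matrix with blocks $\mathcal{B}_{ek}\in\mathbb{R}^{N_eS_e\times Q_k}$, $e=1,\dots,E$, $k=1,\dots,K$, where $\mathcal{B}_{ek}$ is the block column, indexed by $k'\in\mathcal{C}_e$, whose $k'$-th block (of size $S_e\times Q_k$) is $B_{e,k}$ if $k\in\mathcal{C}_e$ and $k'=k$, and $0$ otherwise. Proximal operator: $\mathrm{prox}_{\mu\mathcal{R}}(x)=\arg\min_u\big(\mathcal{R}(u)+\frac{1}{2\mu}\|x-u\|^2\big)$. $\lambda_{\max}$ denotes the largest eigenvalue. *)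

(* Defs.v *)
Set Warnings "-notation-overridden,-notation-incompatible-prefix,-ambiguous-paths".
From HB Require Import structures.
From mathcomp Require Import all_boot all_order all_algebra.
From mathcomp Require Import mxtens.
From mathcomp Require Import all_classical all_reals all_analysis.

Set Implicit Arguments.
Unset Strict Implicit.
Unset Printing Implicit Defensive.

Import Order.TTheory GRing.Theory Num.Theory.
Import numFieldNormedType.Exports.

Local Open Scope classical_set_scope.
Local Open Scope ring_scope.

(* Vectors of R^n are column matrices.  The topology carried by ['cV[R]_n] is
   that of the sup norm [`|_|], hence limits and derivatives are the usual
   ones, but Euclidean norms have to be written with [enorm]. *)

Section Euclidean.
Context {R : realType}.

Definition dotv n (u v : 'cV[R]_n) : R := (u^T *m v) 0 0.

Definition enorm n (v : 'cV[R]_n) : R := Num.sqrt (dotv v v).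

Definition gradient n (f : 'cV[R]_n -> R) (x : 'cV[R]_n) : 'cV[R]_n :=
  \col_i 'D_(delta_mx i 0) (f : _ -> R^o) x.

(* Meant for symmetric [M], whose spectrum is real, finite and, if [0 < n],
   nonempty. *)
Definition lambda_max n (M : 'M[R]_n) : R := sup [set a | eigenvalue M a].

End Euclidean.

Section ConvexAnalysis.
Context {R : realType}.
Local Open Scope ereal_scope.

Definition argmin (T : Type) (D : set T) (f : T -> \bar R) : set T :=
  [set x | D x /\ forall y, D y -> f x <= f y].

(* The values of [f] lie in R with +oo adjoined, and not all are +oo. *)
Definition proper_fun (T : Type) (f : T -> \bar R) : Prop :=
  (forall x, f x != -oo) /\ (exists x, f x != +oo).

Definition closed_fun n (f : 'cV[R]_n -> \bar R) : Prop :=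
  closed [set p : 'cV[R]_n * R | f p.1 <= p.2%:E].

(* For [f] never -oo there is no indeterminate sum on the right-hand side,
   and [0 * +oo] is 0. *)
Definition convex_efun n (f : 'cV[R]_n -> \bar R) : Prop :=
  forall (x y : 'cV[R]_n) (t : R), (0 <= t <= 1)%R ->
    f (t *: x + (1 - t) *: y)%R <= t%:E * f x + (1 - t)%:E * f y.

(* The default value 0 of [xget] is irrelevant: the argmin is a singleton when
   [f] is proper, closed and convex and [0 < mu]. *)
Definition prox n (mu : R) (f : 'cV[R]_n -> \bar R) (x : 'cV[R]_n) : 'cV[R]_n :=
  xget 0%R (argmin setT (fun u => f u + ((2 * mu)^-1 * enorm (x - u) ^+ 2)%:E)).

Definition saddle_point (W V : Type) (L : W -> V -> \bar R) (w : W) (v : V) :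
  Prop := (forall v', L w v' <= L w v) /\ (forall w', L w v <= L w' v).

Definition strong_duality (W V : Type) (L : W -> V -> \bar R) : Prop :=
  ereal_inf [set ereal_sup [set L w v | v in setT] | w in setT] =
  ereal_sup [set ereal_inf [set L w v | w in setT] | v in setT].

End ConvexAnalysis.

(* The agents of [D] in increasing order. *)
Definition agent K (D : {set 'I_K}) (i : 'I_#|D|) : 'I_K := enum_val i.

Section Network.
Context {K : nat} (adj : rel 'I_K).

Definition neighborhood (k : 'I_K) : {set 'I_K} :=
  [set s | (s == k) || adj s k]%SET.

Definition induced_connected (D : {set 'I_K}) : Prop :=
  forall s k, s \in D -> k \in D ->
    connect [rel i j | [&& i \in D, j \in D & adj i j]] s k.

End Network.

Section Combination.
Context {R : realType}.

Definition doubly_stochastic n (A : 'M[R]_n) : Prop :=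
  [/\ forall i j, 0 <= A i j,
      forall i, \sum_j A i j = 1 &
      forall j, \sum_i A i j = 1].

Definition primitive_mx n (A : 'M[R]_n) : Prop :=
  exists2 m : nat, (0 < m)%N & forall i j, 0 < (A ^+ m) i j.

End Combination.

(* Agents are elements of ['I_K] and constraints elements of ['I_E].  Inside
   constraint [e] the agents of [C e] are numbered by ['I_#|C e|] through
   [agent].  A stacked primal vector is [\mxcol_k w_k], with blocks
   [submxcol w k].  A stacked dual vector is [\mxcol_e y_e], where the entry of
   [y_e] of index [mxtens_index (i, s)] is entry [s] of the block of agent
   [agent i]; this is the indexing of [A e *t 1%:M]. *)
Section Problem.
Context {R : realType} {K E : nat}.
Variables (C : 'I_E -> {set 'I_K}) (Q : 'I_K -> nat) (S : 'I_E -> nat).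

Definition primal_dim : nat := (\sum_(k < K) Q k)%N.
Definition dual_dim : nat := (\sum_(e < E) #|C e| * S e)%N.

Definition stacked_cost (J : forall k, 'cV[R]_(Q k) -> R)
    (w : 'cV[R]_primal_dim) : R :=
  \sum_(k < K) J k (submxcol w k).

Definition stacked_reg (Rg : forall k, 'cV[R]_(Q k) -> \bar R)
    (w : 'cV[R]_primal_dim) : \bar R :=
  (\sum_(k < K) Rg k (submxcol w k))%E.

(* [B e k] and [b e k] are used for [k \in C e] only. *)
Variables (B : forall e k, 'M[R]_(S e, Q k)).
Variables (b : forall e, 'I_K -> 'cV[R]_(S e)).

Definition residual (w : 'cV[R]_primal_dim) (e : 'I_E) : 'cV[R]_(S e) :=
  \sum_(k in C e) (B e k *m submxcol w k - b e k).

Definition objective (J : forall k, 'cV[R]_(Q k) -> R)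
    (Rg : forall k, 'cV[R]_(Q k) -> \bar R) (w : 'cV[R]_primal_dim) : \bar R :=
  (\sum_(k < K) ((J k (submxcol w k))%:E + Rg k (submxcol w k)))%E.

Definition feasible : set 'cV[R]_primal_dim :=
  [set w | forall e, residual w e = 0].

Definition lagrangian (J : forall k, 'cV[R]_(Q k) -> R)
    (Rg : forall k, 'cV[R]_(Q k) -> \bar R)
    (w : 'cV[R]_primal_dim) (v : forall e, 'cV[R]_(S e)) : \bar R :=
  (objective J Rg w + (\sum_(e < E) dotv (v e) (residual w e))%:E)%E.

Definition block_B (e : 'I_E) (k : 'I_K) : 'M[R]_(#|C e| * S e, Q k) :=
  \matrix_(i, j)
    if agent (D := C e) (mxtens_unindex i).1 == k
    then B e k (mxtens_unindex i).2 j else 0.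

Definition stacked_B : 'M[R]_(dual_dim, primal_dim) :=
  \mxblock_(e < E, k < K) block_B e k.

Definition block_b (e : 'I_E) : 'cV[R]_(#|C e| * S e) :=
  \col_i b e (agent (D := C e) (mxtens_unindex i).1) (mxtens_unindex i).2 0.

Definition stacked_b : 'cV[R]_dual_dim := \mxcol_(e < E) block_b e.

Definition stacked_A (A : forall e, 'M[R]_#|C e|) : 'M[R]_dual_dim :=
  \mxdiag_(e < E) (A e *t (1%:M : 'M[R]_(S e))).

End Problem.

(* Main.v *)
Require Import Defs.
Set Warnings "-notation-overridden,-notation-incompatible-prefix,-ambiguous-paths".
From HB Require Import structures.
From mathcomp Require Import all_boot all_order all_algebra.
From mathcomp Require Import mxtens.
From mathcomp Require Import ring lra.
From mathcomp Require Import all_classical all_reals all_analysis.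

Set Implicit Arguments.
Unset Strict Implicit.
Unset Printing Implicit Defensive.

Import Order.TTheory GRing.Theory Num.Theory.
Import numFieldNormedType.Exports.

Local Open Scope classical_set_scope.
Local Open Scope ring_scope.

(* A fixed point (ws, ys, xs) of the recursions is read off a saddle point
   (ws, v): ys replicates each multiplier v^e over the agents of C_e, so that ys
   is fixed by the combination matrices, and xs solves U1 Sigma xs = b - B ws,
   which is possible because primitivity makes the range of U1 the orthogonal
   complement of the consensus vectors.  The recursions imply
   U1^T y_i = mu_v (I - Sigma) (x_{i-1} - x_i).  With D = Sigma (I - Sigma),
   positive definite since primitivity puts the lambda_j in (0, 1), the energy
     V_i = |w_i - ws|^2
           + (mu_w / mu_v) (|y_i - ys|^2 + mu_v^2 <x_i - xs, D (x_i - xs)>)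
   then satisfies
     V_{i+1} + mu_w nu |w_i - ws|^2 + mu_w mu_v |Sigma (x_{i+1} - xs)|^2 <= V_i,
   whence w_i -> ws and x_i -> xs.  The y_i are bounded, and any cluster point
   can replace ys in the fixed point; its own energy has a subsequence tending
   to 0 and is nonincreasing, so y_i converges to it. *)

(** * Euclidean space *)

Section Euclidean.
Context {R : realType}.

Lemma dotvE n (u v : 'cV[R]_n) : dotv u v = \sum_i u i 0 * v i 0.
Proof. by rewrite /dotv mxE; apply: eq_bigr => i _; rewrite mxE. Qed.

Lemma dotvC n (u v : 'cV[R]_n) : dotv u v = dotv v u.
Proof. by rewrite !dotvE; apply: eq_bigr => i _; rewrite mulrC. Qed.

Lemma dotvDl n (u v z : 'cV[R]_n) : dotv (u + v) z = dotv u z + dotv v z.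
Proof. by rewrite /dotv linearD /= mulmxDl mxE. Qed.

Lemma dotvDr n (u v z : 'cV[R]_n) : dotv z (u + v) = dotv z u + dotv z v.
Proof. by rewrite dotvC dotvDl !(dotvC z). Qed.

Lemma dotvNl n (u z : 'cV[R]_n) : dotv (- u) z = - dotv u z.
Proof. by rewrite /dotv linearN /= mulNmx mxE. Qed.

Lemma dotvNr n (u z : 'cV[R]_n) : dotv z (- u) = - dotv z u.
Proof. by rewrite dotvC dotvNl (dotvC z). Qed.

Lemma dotvZl n a (u z : 'cV[R]_n) : dotv (a *: u) z = a * dotv u z.
Proof. by rewrite /dotv linearZ /= -scalemxAl mxE. Qed.

Lemma dotvZr n a (u z : 'cV[R]_n) : dotv z (a *: u) = a * dotv z u.
Proof. by rewrite dotvC dotvZl (dotvC z). Qed.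

Lemma dotv0l n (z : 'cV[R]_n) : dotv 0 z = 0.
Proof. by rewrite /dotv trmx0 mul0mx mxE. Qed.

Lemma dotv0r n (z : 'cV[R]_n) : dotv z 0 = 0.
Proof. by rewrite dotvC dotv0l. Qed.

Definition dotv_lin := (dotvDl, dotvDr, dotvNl, dotvNr, dotvZl, dotvZr).

Lemma dotv_mull m n (M : 'M[R]_(m, n)) u v :
  dotv (M *m u) v = dotv u (M^T *m v).
Proof. by rewrite /dotv trmx_mul mulmxA. Qed.

Lemma dotv_ge0 n (u : 'cV[R]_n) : 0 <= dotv u u.
Proof. by rewrite dotvE; apply: sumr_ge0 => i _; rewrite -expr2 sqr_ge0. Qed.

Lemma dotv_coord_le n (u : 'cV[R]_n) i : u i 0 ^+ 2 <= dotv u u.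
Proof.
rewrite dotvE (bigD1 i) //= -expr2 lerDl.
by apply: sumr_ge0 => j _; rewrite -expr2 sqr_ge0.
Qed.

Lemma dotv_eq0 n (u : 'cV[R]_n) : dotv u u = 0 -> u = 0.
Proof.
move=> u0; apply/matrixP => i j; rewrite (ord1 j) mxE; apply/eqP.
rewrite -sqrf_eq0 eq_le sqr_ge0 andbT -u0; exact: dotv_coord_le.
Qed.

Lemma enorm_sqr n (u : 'cV[R]_n) : enorm u ^+ 2 = dotv u u.
Proof. by rewrite /enorm sqr_sqrtr // dotv_ge0. Qed.

Lemma dotv_sqrB n (u v : 'cV[R]_n) :
  dotv (u - v) (u - v) = dotv u u - 2 * dotv u v + dotv v v.
Proof. rewrite !dotv_lin (dotvC v u); lra. Qed.

Lemma norm_mx_le m n (A : 'M[R]_(m, n)) (e : R) :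
  0 <= e -> (forall i j, `|A i j| <= e) -> `|A| <= e.
Proof.
by move=> e0 Ae; rewrite [leLHS]mx_normrE; apply/bigmax_leP; split => // -[].
Qed.

Lemma coord_le_norm_mx m n (A : 'M[R]_(m, n)) i j : `|A i j| <= `|A|.
Proof.
by rewrite [leRHS]mx_normrE; apply/bigmax_geP; right; exists (i, j).
Qed.

Lemma norm_le_enorm n (u : 'cV[R]_n) : `|u| <= enorm u.
Proof.
apply: norm_mx_le => [|i j]; first exact: sqrtr_ge0.
by rewrite (ord1 j) -sqrtr_sqr ler_wsqrtr // dotv_coord_le.
Qed.

Lemma norm_sqr_le_dotv n (u : 'cV[R]_n) : `|u| ^+ 2 <= dotv u u.
Proof.
by rewrite -enorm_sqr lerXn2r ?nnegrE ?sqrtr_ge0 // norm_le_enorm.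
Qed.

Lemma dotv_continuous n : continuous (fun u : 'cV[R]_n => dotv u u).
Proof.
under eq_fun do rewrite dotvE.
apply: (continuous_big add_continuous) => i _ u.
apply: continuousM; exact: coord_continuous.
Qed.

Lemma dotvl_continuous n (a : 'cV[R]_n) : continuous (fun u : 'cV[R]_n => dotv a u).
Proof.
under eq_fun do rewrite dotvE.
apply: (continuous_big add_continuous) => i _ u.
apply: continuousM; [exact: cst_continuous|exact: coord_continuous].
Qed.

Lemma cvg_coord m n (T : Type) (F : set_system T) {FF : Filter F}
    (f : T -> 'M[R]_(m, n)) (l : 'M[R]_(m, n)) :
  (forall i j, f t i j @[t --> F] --> l i j) -> f t @[t --> F] --> l.
Proof.
move=> fl; apply/cvgrPdist_le => e e0.
have H : \forall t \near F, forall i : 'I_m * 'I_n, `|l i.1 i.2 - f t i.1 i.2| <= e.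
  by apply: filter_forall => -[i j]; move/cvgrPdist_le: (fl i j); apply.
apply: filterS H => t H; apply: norm_mx_le => [|i j]; first exact: ltW.
by rewrite !mxE; exact: (H (i, j)).
Qed.

Lemma continuous_mx m n (T : topologicalType) (f : T -> 'M[R]_(m, n)) :
  (forall i j, continuous (fun t => f t i j)) -> continuous f.
Proof.
by move=> fc t; apply: (@cvg_coord _ _ _ (nbhs t)) => i j; exact: fc.
Qed.

Lemma mulmx_continuous m n p (M : 'M[R]_(m, n)) :
  continuous (fun X : 'M[R]_(n, p) => M *m X).
Proof.
apply: continuous_mx => i j.
under eq_fun do rewrite mxE.
apply: (continuous_big add_continuous) => k _ X.
apply: continuousM; [exact: cst_continuous|exact: coord_continuous].
Qed.

Lemma cvg_dotv0 n (u : nat -> 'cV[R]_n) (l : 'cV[R]_n) :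
  dotv (u i - l) (u i - l) @[i --> \oo] --> 0 -> u i @[i --> \oo] --> l.
Proof.
move=> u0; apply/cvgrPdist_lt => e e0.
move/cvgrPdist_lt: u0 => /(_ _ (exprn_gt0 2 e0)); apply: filterS => i /=.
rewrite sub0r normrN ger0_norm ?dotv_ge0 // distrC => h.
rewrite -(@ltr_pXn2r _ 2) ?nnegrE ?normr_ge0 ?(ltW e0) //.
exact: le_lt_trans (norm_sqr_le_dotv _) h.
Qed.

Lemma cvg_dotv n (u v : nat -> 'cV[R]_n) (l k : 'cV[R]_n) :
  u i @[i --> \oo] --> l -> v i @[i --> \oo] --> k ->
  dotv (u i) (v i) @[i --> \oo] --> dotv l k.
Proof.
move=> ul vk; under eq_fun do rewrite dotvE.
rewrite dotvE; apply: (cvg_big add_continuous) => i _.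
have cv (z : nat -> 'cV[R]_n) (t : 'cV[R]_n) : z j @[j --> \oo] --> t ->
    z j i 0 @[j --> \oo] --> t i 0.
  by move=> zt; exact: (@continuous_cvg _ _ _ _ _ z _ t
    (@coord_continuous _ n 1 i 0 t) zt).
by apply: cvgM; exact: cv.
Qed.

Lemma cvg_dotv_sub n (u : nat -> 'cV[R]_n) (l : 'cV[R]_n) :
  u i @[i --> \oo] --> l -> dotv (u i - l) (u i - l) @[i --> \oo] --> 0.
Proof.
move=> ul; rewrite -(dotv0l (0 : 'cV[R]_n)).
have ul0 : u i - l @[i --> \oo] --> (0 : 'cV[R]_n).
  by rewrite -(subrr l); apply: cvgB => //; exact: cvg_cst.
exact: cvg_dotv.
Qed.

Lemma cvg_mulmx m n (M : 'M[R]_(m, n)) (u : nat -> 'cV[R]_n) (l : 'cV[R]_n) :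
  u i @[i --> \oo] --> l -> M *m u i @[i --> \oo] --> M *m l.
Proof.
by move=> ul; exact: (@continuous_cvg _ _ _ _ _ u _ l (@mulmx_continuous m n 1 M l) ul).
Qed.

(** The ball is the image under transposition of a closed bounded set of row vectors, to which
    Heine-Borel in the form [bounded_closed_compact] applies. *)
Lemma ball_compact n (c : 'cV[R]_n) (e : R) :
  compact [set u : 'cV[R]_n | dotv (u - c) (u - c) <= e].
Proof.
pose tr (v : 'rV[R]_n) : 'cV[R]_n := v^T.
have trc : continuous tr.
  apply: continuous_mx => i j.
  by under eq_fun do rewrite mxE; exact: coord_continuous.
pose D := [set v : 'rV[R]_n | dotv (tr v - c) (tr v - c) <= e].
have DE : [set u : 'cV[R]_n | dotv (u - c) (u - c) <= e] = tr @` D.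
  apply/seteqP; split => [u ue|_ [v ve <-] //].
  by exists u^T; rewrite /D /tr /= ?trmxK.
have Dcl : closed D.
  apply: (@preimage_closed _ _ (fun v => dotv (tr v - c) (tr v - c)) [set t | t <= e]);
    last exact: closed_le.
  move=> v _; apply: (@continuous_comp _ _ _ (fun v => tr v - c) (fun u => dotv u u)).
    by apply: continuousB; [exact: trc|exact: cst_continuous].
  exact: dotv_continuous.
have Dbd : bounded_set D.
  exists (Num.sqrt (Num.max e 0) + `|c|); split; first exact: num_real.
  move=> M /ltW hM v /= ve; apply: le_trans hM.
  apply: (@le_trans _ _ `|tr v|).
    apply: norm_mx_le => // i j.
    have -> : v i j = tr v j i by rewrite mxE.
    exact: coord_le_norm_mx.
  rewrite -(subrK c (tr v)); apply: le_trans (ler_normD _ _) _.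
  rewrite lerD2r; apply: le_trans (norm_le_enorm _) _.
  by rewrite ler_wsqrtr // le_max (ve : dotv _ _ <= e).
rewrite DE; apply: (@continuous_compact _ _ tr D); last exact: bounded_closed_compact.
exact: continuous_subspaceT.
Qed.

End Euclidean.

(** * Cluster points and vanishing sequences *)

Section Sequences.
Context {R : realType}.

Lemma cluster_nat (T : topologicalType) (y : nat -> T) l (D : set T) N :
  cluster (y i @[i --> \oo]) l -> nbhs l D -> exists2 i, (N <= i)%N & D (y i).
Proof.
move=> yl lD.
have yN : (y i @[i --> \oo]) [set y i | i in [set i | (N <= i)%N]].
  by exists N => // i /= Ni; exists i.
by have [_ [[i /= Ni <-] Di]] := yl _ _ yN lD; exists i.
Qed.

(** Carries an inequality that holds along a sequence up to a vanishing error over to a cluster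
    point, without extracting a subsequence. *)
Lemma cluster_ge0 (T : topologicalType) (y : nat -> T) l (g : T -> R) (e : nat -> R) :
  cluster (y i @[i --> \oo]) l -> {for l, continuous g} ->
  e i @[i --> \oo] --> 0 -> (forall i, e i <= g (y i)) -> 0 <= g l.
Proof.
move=> yl gc e0 eg; rewrite leNgt; apply/negP => gl.
have h0 : 0 < - g l / 2 by rewrite divr_gt0 ?oppr_gt0.
have [N _ eN] : \forall i \near \oo, `|0 - e i| < - g l / 2.
  by move/cvgrPdist_lt: e0; apply.
have gD : nbhs l [set z | `|g l - g z| < - g l / 2].
  by move/cvgrPdist_lt: gc; apply.
have [i Ni /= gi] := cluster_nat N yl gD.
have := eN i Ni; have := eg i; rewrite /= sub0r normrN => h1 h2.
by move: gi h2; rewrite !ltr_norml => /andP[h3 h4] /andP[h5 h6]; lra.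
Qed.

(** [V] is nonincreasing and bounded below, hence convergent, and its consecutive differences
    dominate [c * u i]. *)
Lemma cvg0_of_decrease (V u : nat -> R) (c : R) :
  0 < c -> (forall i, 0 <= V i) -> (forall i, 0 <= u i) ->
  (forall i, V i.+1 + c * u i <= V i) -> u i @[i --> \oo] --> 0.
Proof.
move=> c0 V0 u0 Vu.
have Vd i : V i.+1 <= V i by apply: le_trans (Vu i); rewrite lerDl mulr_ge0 // ltW.
have Vcv : cvgn V.
  apply: nonincreasing_is_cvgn; last by exists 0 => _ [i _ <-].
  by apply/nonincreasing_seqP.
have d0 : V i - V i.+1 @[i --> \oo] --> 0.
  rewrite -(subrr (limn V)); apply: cvgB => //.
  by rewrite (cvg_shiftS V).
apply/cvgrPdist_le => e e0.
move/cvgrPdist_le: d0 => /(_ _ (mulr_gt0 c0 e0)); apply: filterS => i /=.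
rewrite !sub0r !normrN !ger0_norm ?subr_ge0 // => h.
by rewrite -(ler_pM2l c0); have := Vu i; lra.
Qed.

Lemma cvg_dotv0_bounded n (p q : nat -> 'cV[R]_n) (M : R) :
  p i @[i --> \oo] --> (0 : 'cV[R]_n) -> (forall i, dotv (q i) (q i) <= M) ->
  dotv (p i) (q i) @[i --> \oo] --> 0.
Proof.
move=> p0 qM.
have M0 : 0 < M + 1 by have := qM 0; have := dotv_ge0 (q 0%N); lra.
(* Cauchy-Schwarz, from the square of [(M + 1) *: p i - dotv (p i) (q i) *: q i]; taking [M + 1]
   instead of [M] gives a positive divisor. *)
have CS i : dotv (p i) (q i) ^+ 2 <= (M + 1) * dotv (p i) (p i).
  have := dotv_ge0 ((M + 1) *: p i - dotv (p i) (q i) *: q i).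
  rewrite dotv_sqrB !dotvZl !dotvZr => h.
  have h2 := ler_wpM2l (sqr_ge0 (dotv (p i) (q i))) (qM i).
  by rewrite -(ler_pM2l M0); nra.
have pp := cvg_dotv p0 p0; rewrite dotv0l in pp.
apply/cvgrPdist_lt => e e0.
have e1 : 0 < e ^+ 2 / (M + 1) by rewrite divr_gt0 // exprn_gt0.
move/cvgrPdist_lt: pp => /(_ _ e1); apply: filterS => i /=.
rewrite !sub0r !normrN (ger0_norm (dotv_ge0 _)) ltr_pdivlMr // mulrC => h.
rewrite -(@ltr_pXn2r _ 2) ?nnegrE ?normr_ge0 ?(ltW e0) //.
by rewrite real_normK ?num_real //; exact: le_lt_trans (CS i) h.
Qed.

End Sequences.

(** * Convex functions *)

Section ConvexAnalysis.
Context {R : realType}.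

Lemma lin_ge0_at0 (a c : R) :
  (forall t, 0 < t <= 1 -> 0 <= a + c * t) -> 0 <= a.
Proof.
move=> h; rewrite leNgt; apply/negP => a0.
have c0 : 0 <= `|c| by [].
have d0 : 0 < - a + `|c| by lra.
(* This choice makes |c| t smaller than -a / 2, so that a + c t < 0. *)
pose t := - a / (- a + `|c|) / 2.
have t1 : 2 * t * (- a + `|c|) = - a by rewrite /t; field; lra.
have t0 : 0 < t by rewrite /t !divr_gt0 //; lra.
have /h : 0 < t <= 1 by apply/andP; split=> //; nra.
have := ler_norm c; nra.
Qed.

Lemma sphere_compact n : compact [set u : 'cV[R]_n | dotv u u = 1].
Proof.
apply: (subclosed_compact _ (@ball_compact R n 0 1)).
  apply: (@preimage_closed _ _ (fun v : 'cV[R]_n => dotv v v) [set t | t = 1]).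
    by move=> v _; exact: dotv_continuous.
  exact: closed_eq.
by move=> u u1; rewrite /= subr0 (u1 : dotv u u = 1).
Qed.

(** The maximum [rho] of |B u|^2 is attained on the compact unit sphere, and stationarity there
    makes [rho] an eigenvalue, hence at most the supremum [lambda_max]. *)
Lemma lambda_maxP m n (B : 'M[R]_(m, n)) w :
  dotv (B *m w) (B *m w) <= lambda_max (B^T *m B) * dotv w w.
Proof.
have [->|w0] := eqVneq w 0; first by rewrite mulmx0 !dotv0l mulr0.
have nz (v : 'cV[R]_n) : v != 0 -> 0 < dotv v v.
  move=> v0; rewrite lt_def dotv_ge0 andbT.
  by apply: contra v0 => /eqP/dotv_eq0 ->.
pose nrm (v : 'cV[R]_n) : 'cV[R]_n := (enorm v)^-1 *: v.
have nrm1 (v : 'cV[R]_n) : v != 0 -> dotv (nrm v) (nrm v) = 1.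
  move=> /nz v0; rewrite !dotv_lin mulrA -invfM -expr2 enorm_sqr mulVf //.
  by rewrite gt_eqF.
have [||p] := compact_EVT_max (f := fun u => dotv (B *m u) (B *m u)) _
  (@sphere_compact n).
- by exists (nrm w) => /=; exact: nrm1.
- apply: continuous_subspaceT => u.
  apply: (@continuous_comp _ _ _ (fun v => B *m v) (fun v => dotv v v)).
    exact: mulmx_continuous.
  exact: dotv_continuous.
rewrite inE /= => p1 pmax.
pose rho : R := dotv (B *m p) (B *m p).
have {}pmax (u : 'cV[R]_n) : dotv u u = 1 -> dotv (B *m u) (B *m u) <= rho.
  by move=> u1; apply: pmax; rewrite inE.
have rhoP v : dotv (B *m v) (B *m v) <= rho * dotv v v.
  have [->|v0] := eqVneq v 0; first by rewrite mulmx0 !dotv0l mulr0.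
  have := pmax _ (nrm1 _ v0).
  rewrite /nrm -scalemxAr !dotv_lin mulrA -invfM -expr2 enorm_sqr.
  by rewrite ler_pdivrMl ?nz // mulrC.
(* [z] is the defect in the eigenvector equation at [p]. The form rho |u|^2 - |B u|^2 is nonnegative
   and vanishes at [p]; at [p - t *: z] its first-order term is -2 t |z|^2, which forces z = 0. *)
have [z zd] : exists z, z = rho *: p - B^T *m (B *m p) by eexists.
have zE : dotv z z = rho * dotv p z - dotv (B *m p) (B *m z).
  by rewrite {1}zd !dotv_lin dotv_mull trmxK.
have z0 : z = 0.
  apply: dotv_eq0; apply/eqP; rewrite eq_le dotv_ge0 andbT -oppr_ge0.
  apply: (@lin_ge0_at0 _ ((rho * dotv z z - dotv (B *m z) (B *m z)) / 2)).
  move=> t /andP[t0 _].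
  have := rhoP (p - t *: z).
  rewrite mulmxBr -scalemxAr !dotv_sqrB !dotv_lin p1 -/rho => h.
  by rewrite -(pmulr_rge0 _ t0) zE; rewrite zE in h; lra.
(* An upper bound on the set of eigenvalues lets [sup] dominate its members. [eigenvalue] refers to
   row vectors, whence the transpositions. *)
have bnd a : eigenvalue (B^T *m B) a -> a <= rho.
  move=> /eigenvalueP[v vM v0].
  have v1 : v^T != 0 by rewrite -(inj_eq (@trmx_inj _ _ _)) trmxK trmx0.
  have := rhoP v^T; rewrite dotv_mull.
  have -> : B^T *m (B *m v^T) = a *: v^T.
    by rewrite mulmxA -linearZ /= -vM trmx_mul trmx_mul trmxK.
  by rewrite dotvZr ler_pM2r // nz.
apply: le_trans (rhoP w) _; apply: ler_wpM2r; first exact: dotv_ge0.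
apply: ub_le_sup; first by exists rho => a /bnd.
rewrite /=; apply/eigenvalueP; exists p^T.
  apply: trmx_inj; rewrite trmx_mul linearZ /= trmx_mul !trmxK -mulmxA.
  by apply/eqP; rewrite eq_sym -subr_eq0 -zd z0.
apply/eqP => p0; move: p1; rewrite -(trmxK p) p0 trmx0 dotv0l => /eqP.
by rewrite eq_sym oner_eq0.
Qed.

(** Finiteness at [p] is included because for [f p = -oo] the inequality would hold for every
    [g]. *)
Definition subgradient n (f : 'cV[R]_n -> \bar R) (p g : 'cV[R]_n) : Prop :=
  f p \is a fin_num /\ forall u, (f p + (dotv g (u - p))%:E <= f u)%E.

Lemma subgradient_mono n (f : 'cV[R]_n -> \bar R) p g q h :
  subgradient f p g -> subgradient f q h -> 0 <= dotv (g - h) (p - q).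
Proof.
move=> [/fineK fp gP] [/fineK fq hP].
have := gP q; have := hP p; rewrite -fp -fq -!EFinD !lee_fin !dotv_lin; lra.
Qed.

(** Fermat's rule for f + h. On the segment from [p] to [u], convexity bounds [f] and a quadratic
    majorant touching at [p] bounds [h]; after division by [t] the term in [c] vanishes as t tends
    to 0. It serves both for the proximal step and for the Lagrangian. *)
Lemma min_subgradient n (f : 'cV[R]_n -> \bar R) (h : 'cV[R]_n -> R) p g c :
  convex_efun f -> (forall u, f u != -oo%E) -> (exists u, f u != +oo%E) ->
  (forall u, h u <= h p + dotv g (u - p) + c * dotv (u - p) (u - p)) ->
  (forall u, (f p + (h p)%:E <= f u + (h u)%:E)%E) ->
  subgradient f p (- g).
Proof.
move=> fcvx fN [u0 fu0] hP minp.
have fpy : f p != +oo%E.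
  apply/eqP => fp; have := minp u0; rewrite fp.
  by case: (f u0) fu0 (fN u0) => //.
have fpf : f p \is a fin_num by rewrite fin_numE fN fpy.
split=> // u; rewrite -(fineK fpf).
case fu : (f u) => [r| |]; last by have := fN u; rewrite fu.
  rewrite -EFinD lee_fin dotvNl -subr_ge0.
  apply: (@lin_ge0_at0 _ (c * dotv (u - p) (u - p))) => t /andP[t0 t1].
  have ut : t *: u + (1 - t) *: p - p = t *: (u - p).
    by rewrite scalerBl scale1r scalerBr [p - _]addrC addrA addrK.
  have t01 : 0 <= t <= 1 by rewrite (ltW t0) t1.
  have := le_trans (minp (t *: u + (1 - t) *: p)) (leeD2r _ (fcvx u p t t01)).
  rewrite fu -(fineK fpf).
  rewrite -!EFinM -!EFinD lee_fin => h1.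
  have := hP (t *: u + (1 - t) *: p); rewrite ut !dotv_lin => h2.
  rewrite -(pmulr_rge0 _ t0); lra.
by rewrite leey.
Qed.

(** The subgradient yields an affine minorant, which makes the objective coercive. Minimizing t +
    q(u) over the epigraph lets closedness stand in for lower semicontinuity: the part of the
    epigraph below level [hi] is compact. *)
Lemma argmin_prox_nonempty n (f : 'cV[R]_n -> \bar R) mu x p g :
  0 < mu -> closed_fun f -> subgradient f p g ->
  argmin setT (fun u => f u + ((2 * mu)^-1 * enorm (x - u) ^+ 2)%:E)%E !=set0.
Proof.
move=> mu0 fcl [fp gP].
pose q (u : 'cV[R]_n) : R := (2 * mu)^-1 * dotv (u - x) (u - x).
have qE u : (2 * mu)^-1 * enorm (x - u) ^+ 2 = q u.
  by rewrite enorm_sqr /q -opprB dotvNl dotvNr opprK.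
(* [hi] is the value at [p]. Below it, [e] bounds |d|^2 for d = u - x and [lo] bounds t; both come
   from Young's inequality -<g, d> <= |d|^2 / (4 mu) + mu |g|^2. *)
pose a := fine (f p); pose hi := a + q p.
pose e := 4 * mu * (q p + mu * dotv g g - dotv g (x - p)).
pose lo := a - mu * dotv g g - e / (4 * mu) + dotv g (x - p).
pose F (z : 'cV[R]_n * R) : R := z.2 + q z.1.
have Fc : continuous F.
  have qc : continuous q.
    move=> u; rewrite /q; apply: (@continuousM _ _ (fun=> (2 * mu)^-1)
      (fun v : 'cV[R]_n => dotv (v - x) (v - x)) u); first exact: cst_continuous.
    apply: (@continuous_comp _ _ _ (fun v : 'cV[R]_n => v - x) (fun v => dotv v v)).
      by apply: continuousB; [exact: cvg_id|exact: cst_continuous].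
    exact: dotv_continuous.
  move=> z; apply: (@continuousD _ _ _ (fun z => z.2) (fun z => q z.1)).
    exact: cvg_snd.
  apply: (@continuous_comp _ _ _ (fun z : 'cV[R]_n * R => z.1) q); first exact: cvg_fst.
  exact: qc.
pose D := [set z : 'cV[R]_n * R | (f z.1 <= z.2%:E)%E] `&` [set z | F z <= hi].
have Dcl : closed D.
  apply: closedI; first exact: fcl.
  apply: (@preimage_closed _ _ F [set t | t <= hi]); last exact: closed_le.
  by move=> z _; exact: Fc.
have Dbox : D `<=` [set u : 'cV[R]_n | dotv (u - x) (u - x) <= e] `*` `[lo, hi].
  move=> [u t] [/= ft Ft].
  have := le_trans (gP u) ft; rewrite -(fineK fp) -EFinD lee_fin => h1.
  have uxp : u - p = (u - x) + (x - p) by rewrite addrA subrK.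
  rewrite uxp dotvDr in h1.
  rewrite /F /= /q in Ft; move: h1 Ft; rewrite -/a /=.
  move: (u - x) => d h1 Ft.
  have dd : dotv d d = 2 * mu * ((2 * mu)^-1 * dotv d d) by field; lra.
  have dd4 : dotv d d / (4 * mu) = ((2 * mu)^-1 * dotv d d) / 2 by field; lra.
  have q0 : 0 <= (2 * mu)^-1 * dotv d d.
    by rewrite mulr_ge0 ?dotv_ge0 // invr_ge0; lra.
  move: ((2 * mu)^-1 * dotv d d) => s in Ft dd dd4 q0 *.
  have : 0 <= 2 * mu * s + 4 * mu * dotv g d + 4 * mu * mu * dotv g g.
    have := dotv_ge0 (d + (2 * mu) *: g).
    by rewrite !dotv_lin (dotvC d g) dd; lra.
  have -> : 2 * mu * s + 4 * mu * dotv g d + 4 * mu * mu * dotv g g =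
    (4 * mu) * (s / 2 + dotv g d + mu * dotv g g) by field.
  rewrite pmulr_rge0; last lra.
  move=> h2; rewrite /hi in Ft.
  have e1 : dotv d d <= e.
    rewrite dd (_ : 2 * mu * s = 4 * mu * (s / 2)); last by field.
    by rewrite /e ler_pM2l; lra.
  split => //=; rewrite in_itv /=; apply/andP; split; last by rewrite /hi; lra.
  have : dotv d d / (4 * mu) <= e / (4 * mu) by rewrite ler_pM2r // invr_gt0; lra.
  by rewrite /lo dd4; lra.
have Dco : compact D.
  have boxco : compact ([set u : 'cV[R]_n | dotv (u - x) (u - x) <= e] `*` `[lo, hi]).
    by apply: compact_setX; [exact: ball_compact|exact: segment_compact].
  exact: (subclosed_compact Dcl boxco Dbox).
have D0 : D (p, a) by split => /=; rewrite ?fineK // /F /= /hi.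
have [||[u0 t0]] := compact_EVT_min (f := F) _ Dco.
- by exists (p, a).
- exact: continuous_subspaceT.
rewrite inE => -[/= fu0 Fu0] minD.
exists u0; split => // u _; rewrite !qE.
apply: le_trans (leeD2r _ fu0) _.
case fu : (f u) => [r| |]; last by have := gP u; rewrite fu -(fineK fp).
  rewrite -!EFinD lee_fin.
  have [h|h] := leP (r + q u) hi; last by apply: le_trans Fu0 (ltW h).
  by have := minD (u, r); rewrite inE; apply; split => //=; rewrite fu.
by rewrite leey.
Qed.

End ConvexAnalysis.

(** * Combination matrices *)

Section CombinationMatrices.
Context {R : realType}.

Lemma diag_mx_inj n (d : 'rV[R]_n) (q : 'cV[R]_n) :
  (forall i, d 0 i != 0) -> diag_mx d *m q = 0 -> q = 0.
Proof.
move=> d0 /matrixP dq; apply/matrixP => i j; have := dq i j.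
rewrite mul_diag_mx !mxE => /eqP; rewrite mulf_eq0 (negbTE (d0 i)) /=.
by move/eqP.
Qed.

Lemma mulmx_exp_eigen n (A : 'M[R]_n) (a : R) (v : 'cV[R]_n) m :
  A *m v = a *: v -> A ^+ m *m v = a ^+ m *: v.
Proof.
move=> Av; elim: m => [|m IH]; first by rewrite !expr0 mul1mx scale1r.
by rewrite exprSr -mulmxA Av -scalemxAr IH scalerA -exprS.
Qed.

Lemma exp_row_sum n (A : 'M[R]_n) m i :
  (forall i, \sum_j A i j = 1) -> \sum_j (A ^+ m) i j = 1.
Proof.
move=> A1; have /(mulmx_exp_eigen m) : A *m const_mx 1 = 1 *: const_mx 1 :> 'cV_n.
  apply/matrixP => k l; rewrite !mxE mul1r -[RHS](A1 k).
  by apply: eq_bigr => j _; rewrite mxE mulr1.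
move=> /matrixP/(_ i 0); rewrite expr1n !mxE mul1r => <-.
by apply: eq_bigr => j _; rewrite mxE mulr1.
Qed.

(** At a coordinate of largest modulus, averaging with the weights of a row cannot increase the
    modulus. *)
Lemma stochastic_eigen_le1 n (A : 'M[R]_n) (a : R) (v : 'cV[R]_n) :
  doubly_stochastic A -> A *m v = a *: v -> v != 0 -> `|a| <= 1.
Proof.
move=> [A0 A1 _] Av v0.
have : exists i, v i 0 != 0.
  apply/existsP; apply: contraT; rewrite negb_exists => /forallP v_eq0.
  case/eqP: v0; apply/matrixP => i j; rewrite (ord1 j) mxE.
  by apply/eqP; rewrite -[_ == _]negbK v_eq0.
move=> [i0 vi0].
have [i _ imax] := @arg_maxP _ R 'I_n i0 xpredT (fun i => `|v i 0|) isT.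
have vi : 0 < `|v i 0| by apply: lt_le_trans (imax i0 isT); rewrite normr_gt0.
rewrite -(ler_pM2r vi) mul1r -normrM.
have <- : (A *m v) i 0 = a * v i 0 by rewrite Av mxE.
rewrite mxE; apply: le_trans (ler_norm_sum _ _ _) _.
rewrite -[leRHS]mul1r -(A1 i) mulr_suml; apply: ler_sum => j _.
by rewrite normrM ger0_norm // ler_wpM2l //; exact: imax.
Qed.

(** Equality case of the maximum principle. At a coordinate [i] of largest modulus, row [i] of the
    positive matrix [P] averages the entries of [v] to a number of that same modulus; since all
    weights are positive, every entry equals this average. *)
Lemma primitive_eigen_const n (A : 'M[R]_n) (a : R) (v : 'cV[R]_n) :
  doubly_stochastic A -> primitive_mx A -> A *m v = a *: v -> `|a| = 1 ->
  exists c, v = const_mx c.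
Proof.
move=> [A0 A1 _] [m m0 Am] Av a1.
have [->|v0] := eqVneq v 0; first by exists 0; apply/matrixP => i j; rewrite !mxE.
case: n => [|n] in A v A0 A1 Am Av v0 *.
  by exists 0; apply/matrixP => -[].
have [i _ imax] := @arg_maxP _ R 'I_n.+1 0 xpredT (fun i => `|v i 0|) isT.
pose P := A ^+ m; have P1 : \sum_j P i j = 1 by exact: exp_row_sum.
have Pv : \sum_j P i j * v j 0 = a ^+ m * v i 0.
  have /matrixP/(_ i 0) := mulmx_exp_eigen m Av.
  by rewrite !mxE.
(* The sign [s] turns a^m v_i into its modulus, so that a = 1 and a = -1 are treated together. *)
have [s s1 sE] : exists2 s : R, `|s| = 1 & s * (a ^+ m * v i 0) = `|v i 0|.
  have e : `|a ^+ m * v i 0| = `|v i 0| by rewrite normrM normrX a1 expr1n mul1r.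
  have [h|h] := leP 0 (a ^+ m * v i 0).
    by exists 1; rewrite ?normr1 // -e mul1r ger0_norm.
  by exists (-1); rewrite ?normrN1 // -e mulN1r ltr0_norm.
have terms j : 0 <= P i j * (`|v i 0| - s * v j 0).
  apply: mulr_ge0; first exact: ltW (Am _ _).
  rewrite subr_ge0; apply: le_trans (ler_norm _) _.
  by rewrite normrM s1 mul1r; exact: imax.
have sum0 : \sum_j P i j * (`|v i 0| - s * v j 0) = 0.
  under eq_bigr do rewrite mulrBr mulrCA.
  by rewrite sumrB -mulr_suml P1 mul1r -mulr_sumr Pv sE subrr.
have vj j : s * v j 0 = `|v i 0|.
  have /eqP := sum0; rewrite psumr_eq0 // => /allP/(_ j).
  rewrite mem_index_enum => /(_ isT) /=.
  by rewrite mulf_eq0 gt_eqF ?Am //= subr_eq0 => /eqP <-.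
have ss : s * s = 1 by rewrite -expr2 -[s ^+ 2]real_normK ?num_real // s1 expr1n.
exists (s * `|v i 0|); apply/matrixP => j k; rewrite (ord1 k) mxE.
by rewrite -(vj j) mulrA ss mul1r.
Qed.

(** The value -1 is excluded because its eigenvector would be constant, and constant vectors are
    fixed by [A]. *)
Lemma primitive_eigen_bounds n (A : 'M[R]_n) (a : R) (v : 'cV[R]_n) :
  doubly_stochastic A -> primitive_mx A -> A *m v = a *: v -> v != 0 ->
  -1 < a <= 1.
Proof.
move=> dsA prA Av v0; have := stochastic_eigen_le1 dsA Av v0.
rewrite ler_norml => /andP[aN1 ->]; rewrite andbT lt_neqAle aN1 andbT.
apply: contra v0 => /eqP aE; rewrite -aE in Av.
have [c vc] := primitive_eigen_const dsA prA Av (normrN1 _).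
case: dsA => _ A1 _.
apply/eqP/matrixP => i j; have /matrixP/(_ i j) := Av.
rewrite vc !mxE; under eq_bigr do rewrite mxE.
by rewrite -mulr_suml A1; lra.
Qed.

Variables (E : nat) (d S : 'I_E -> nat).

(* The component [s] of block [e] of a stacked dual vector, as a function of
   the agent. *)
Definition fiber (z : 'cV[R]_(\sum_e d e * S e)) e (s : 'I_(S e)) : 'cV[R]_(d e) :=
  \col_i submxcol z e (mxtens_index (i, s)) 0.

Lemma fiber_inj z z' : (forall e (s : 'I_(S e)), fiber z s = fiber z' s) -> z = z'.
Proof.
move=> h; apply/mxcolP => e; apply/matrixP => k j; rewrite (ord1 j).
have /matrixP/(_ (mxtens_unindex k).1 0) := h e (mxtens_unindex k).2.
by rewrite !mxE -surjective_pairing mxtens_unindexK.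
Qed.

Lemma fiberZ a z e (s : 'I_(S e)) : fiber (a *: z) s = a *: fiber z s.
Proof. by apply/matrixP => i j; rewrite !mxE. Qed.

Lemma fiber0 e (s : 'I_(S e)) : fiber 0 s = 0.
Proof. by apply/matrixP => i j; rewrite !mxE. Qed.

Lemma dotv_mxcol (p_ : 'I_E -> nat) (z z' : 'cV[R]_(\sum_e p_ e)) :
  dotv z z' = \sum_e dotv (submxcol z e) (submxcol z' e).
Proof.
rewrite /dotv -{1}[z]submxcolK -{1}[z']submxcolK tr_mxcol mul_mxrow_mxcol.
by rewrite summxE.
Qed.

Lemma sum_mxtens m n (F : 'I_(m * n) -> R) :
  \sum_k F k = \sum_i \sum_j F (mxtens_index (i, j)).
Proof.
rewrite (reindex (@mxtens_index m n)) /=; last first.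
  by exists (@mxtens_unindex _ _) => k _; rewrite (mxtens_indexK, mxtens_unindexK).
by rewrite pair_bigA; apply: eq_bigr => -[].
Qed.

Lemma dotv_fiber z z' :
  dotv z z' = \sum_e \sum_(s < S e) dotv (fiber z s) (fiber z' s).
Proof.
rewrite dotv_mxcol; apply: eq_bigr => e _.
rewrite dotvE sum_mxtens exchange_big /=; apply: eq_bigr => s _; rewrite dotvE.
by apply: eq_bigr => i _; rewrite !mxE.
Qed.

(** Reduces spectral questions about the stacked matrix to the single matrices [A e]. *)
Lemma fiber_mulA (A : forall e, 'M[R]_(d e)) z e (s : 'I_(S e)) :
  fiber ((\mxdiag_e (A e *t (1%:M : 'M[R]_(S e)))) *m z) s = A e *m fiber z s.
Proof.
rewrite -{1}[z]submxcolK mul_mxdiag_mxcol; apply/matrixP => i j.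
rewrite mxE mxcolK !mxE sum_mxtens.
apply: eq_bigr => k _; rewrite (bigD1 s) //= big1 ?addr0; last first.
  by move=> t ts; rewrite tensmxE !mxE eq_sym (negbTE ts) mulr0 mul0r.
by rewrite tensmxE !mxE eqxx mulr1.
Qed.

End CombinationMatrices.

(** * Spectrum, kernel and range in the reduced eigendecomposition *)

Section ReducedDecomposition.
Context {R : realType} (E : nat) (d S : 'I_E -> nat) (A : forall e, 'M[R]_(d e)).
Context (r : nat) (U : 'M[R]_(\sum_e d e * S e, r)) (lam : 'rV[R]_r).

Let cA : 'M[R]_(\sum_e d e * S e) := \mxdiag_e (A e *t (1%:M : 'M[R]_(S e))).

Hypothesis dsA : forall e, doubly_stochastic (A e).
Hypothesis prA : forall e, primitive_mx (A e).
Hypothesis UU : U^T *m U = 1%:M.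
Hypothesis eigA : 2^-1 *: (1%:M - cA) = U *m diag_mx lam *m U^T.
Hypothesis lam0 : forall i, lam 0 i != 0.

Lemma mulA_eigen (z : 'cV[R]_(\sum_e d e * S e)) :
  cA *m z = z - 2 *: (U *m (diag_mx lam *m (U^T *m z))).
Proof.
rewrite !mulmxA -eigA -scalemxAl scalerA mulfV ?scale1r ?pnatr_eq0 //.
by rewrite mulmxBl mul1mx opprB addrC subrK.
Qed.

(** Column [i] of [U] is an eigenvector of [cA] for 1 - 2 lambda_i, and so is one of its nonzero
    fibers for some [A e]. Primitivity then gives 0 <= lambda_i < 1, and [lam0] excludes 0. *)
Lemma lam_bounds i : 0 < lam 0 i < 1.
Proof.
pose u := col i U.
have uu : dotv u u = 1.
  have : (U^T *m U) i i = 1 by rewrite UU mxE eqxx.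
  by rewrite mxE dotvE => <-; apply: eq_bigr => k _; rewrite !mxE.
have u0 : u != 0.
  apply/eqP => u0; move: uu; rewrite u0 dotv0l => /eqP.
  by rewrite eq_sym oner_eq0.
have Au : cA *m u = (1 - 2 * lam 0 i) *: u.
  rewrite mulA_eigen.
  have -> : U^T *m u = delta_mx i 0.
    rewrite /u colE mulmxA UU mul1mx //.
  have -> : diag_mx lam *m delta_mx i 0 = lam 0 i *: delta_mx i 0 :> 'cV_r.
    apply/matrixP => k l; rewrite mul_diag_mx !mxE.
    by case: (eqVneq k i) => [->|_] //=; rewrite !mulr0.
  by rewrite -scalemxAr -colE -/u scalerA scalerBl scale1r.
have [e [s us]] : exists e (s : 'I_(S e)), fiber u s != 0.
  apply: contrapT => h; case/eqP: u0; apply: fiber_inj => e s.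
  rewrite fiber0; apply/eqP; apply: contrapT => /negP us.
  by apply: h; exists e, s.
have fu : A e *m fiber u s = (1 - 2 * lam 0 i) *: fiber u s.
  by rewrite -fiberZ -Au fiber_mulA.
have := primitive_eigen_bounds (dsA e) (prA e) fu us.
have := lam0 i; rewrite neq_lt; lra.
Qed.

(** Row sums equal to one make [z] a fixed vector of [cA], so U Lambda U^T z = 0; orthonormality and
    [lam0] cancel the two left factors. *)
Lemma consensus_kernel (z : 'cV[R]_(\sum_e d e * S e)) :
  (forall e (s : 'I_(S e)), exists c, fiber z s = const_mx c) -> U^T *m z = 0.
Proof.
move=> zc; apply: (diag_mx_inj lam0).
have Az : cA *m z = z.
  apply: fiber_inj => e s; rewrite fiber_mulA; have [c ->] := zc e s.
  case: (dsA e) => _ A1 _; apply/matrixP => i j; rewrite !mxE.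
  by under eq_bigr do rewrite mxE; rewrite -mulr_suml A1 mul1r.
have := mulA_eigen z; rewrite Az => /eqP.
rewrite eq_sym -subr_eq0 addrC addrA addNr add0r oppr_eq0 scaler_eq0.
rewrite pnatr_eq0 /= => /eqP/(congr1 (mulmx U^T)).
by rewrite (mulmxA U^T U) UU mul1mx mulmx0.
Qed.

(** The defect p = z - U U^T z is killed by U^T, hence fixed by [cA], hence constant on fibers by
    primitivity. It is therefore orthogonal to [z] as well as to the range of [U], that is, to
    itself. *)
Lemma zero_sum_range (z : 'cV[R]_(\sum_e d e * S e)) :
  (forall e (s : 'I_(S e)), \sum_i fiber z s i 0 = 0) -> U *m (U^T *m z) = z.
Proof.
move=> zs; pose p := z - U *m (U^T *m z).
have Up : U^T *m p = 0 by rewrite /p mulmxBr (mulmxA U^T U) UU mul1mx subrr.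
have Ap : cA *m p = 1 *: p by rewrite mulA_eigen Up !mulmx0 scaler0 subr0 scale1r.
have pz : dotv p z = 0.
  rewrite dotv_fiber big1 // => e _; rewrite big1 // => s _.
  have fp : A e *m fiber p s = 1 *: fiber p s by rewrite -fiberZ -Ap fiber_mulA.
  have [c ->] := primitive_eigen_const (dsA e) (prA e) fp (normr1 _).
  rewrite dotvE; under eq_bigr do rewrite mxE.
  by rewrite -mulr_sumr zs mulr0.
have p0 : p = 0.
  apply: dotv_eq0; rewrite {2}/p dotvDr dotvNr pz dotvC dotv_mull Up.
  by rewrite dotv0r subrr.
by apply/eqP; rewrite eq_sym -subr_eq0 -/p p0.
Qed.

End ReducedDecomposition.

(** * Energy decrease and convergence *)

Section Convergence.
Context {R : realType} (n m r : nat).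
Context (f : 'cV[R]_n -> \bar R) (J : 'cV[R]_n -> R) (G : 'cV[R]_n -> 'cV[R]_n).
Context (B : 'M[R]_(m, n)) (b : 'cV[R]_m) (U : 'M[R]_(m, r)) (lam : 'rV[R]_r).
Context (delta nu mw mv : R).

Hypothesis nu0 : 0 < nu.
Hypothesis nu_le : nu <= delta.
Hypothesis Glip : forall u u', enorm (G u - G u') <= delta * enorm (u - u').
Hypothesis Gstr : forall u u',
  J u - J u' + nu / 2 * enorm (u - u') ^+ 2 <= dotv (u - u') (G u).

(* Strong convexity at [u] and the Lipschitz bound on the gradient give the
   descent inequality with [2 * delta - nu] in place of the sharp [delta], without
   integrating the gradient; this is where the bound on [mu_w] comes from. *)
Lemma descent u u' :
  J u <= J u' + dotv (G u') (u - u') +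
         (2 * delta - nu) / 2 * dotv (u - u') (u - u').
Proof.
have d0 : 0 < delta by exact: lt_le_trans nu_le.
have h1 := Gstr u u'; rewrite enorm_sqr in h1.
have h2 : dotv (G u - G u') (G u - G u') <= delta ^+ 2 * dotv (u - u') (u - u').
  rewrite -!enorm_sqr -exprMn lerXn2r ?nnegrE ?sqrtr_ge0 ?Glip //.
  by rewrite mulr_ge0 ?sqrtr_ge0 // ltW.
have h3 : dotv (G u - G u') (u - u') <= delta * dotv (u - u') (u - u').
  have := dotv_ge0 (delta *: (u - u') - (G u - G u')).
  rewrite (dotv_sqrB (delta *: _)) !(dotvZl, dotvZr) (dotvC (u - u') (G u - G u')) => h.
  by rewrite -(ler_pM2l d0); lra.
by rewrite dotvDl dotvNl in h3; rewrite (dotvC _ (G u)) in h1; lra.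
Qed.

Let Sg := diag_mx lam.
Let W := Sg *m (1%:M - Sg).

Hypothesis UU : U^T *m U = 1%:M.
Hypothesis lam01 : forall i, 0 < lam 0 i < 1.
Hypothesis mw0 : 0 < mw.
Hypothesis mv0 : 0 < mv.
Hypothesis mw_le : mw * (2 * delta - nu) <= 1.
Hypothesis mv_le : forall u, mv * dotv (B *m u) (B *m u) <= nu * dotv u u.

Lemma W_ge0 q : 0 <= dotv q (W *m q).
Proof.
rewrite dotvE; apply: sumr_ge0 => i _.
rewrite /W /Sg -mulmxA mulmxBl mul1mx mul_diag_mx mxE mul_diag_mx !mxE.
have /andP[l0 l1] := lam01 i.
have -> : q i 0 * (lam 0 i * (q i 0 - lam 0 i * q i 0)) =
  lam 0 i * (1 - lam 0 i) * q i 0 ^+ 2 by ring.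
apply: mulr_ge0; last exact: sqr_ge0.
by apply: mulr_ge0; [exact: ltW|rewrite subr_ge0 ltW].
Qed.

Lemma trSg : Sg^T = Sg. Proof. exact: tr_diag_mx. Qed.

Lemma trW : W^T = W.
Proof.
rewrite /W trmx_mul linearB /= trmx1 trSg mulmxBr mulmxBl.
by rewrite mulmx1 mul1mx.
Qed.

(** The update of [x] determines U^T (y + mv z), and inserting it into the update of [y] leaves a
    difference of successive [x]. This evaluates the cross term of the energy and later shows that
    U^T y_i tends to 0. *)
Lemma dual_step (y y' z : 'cV[R]_m) (x x' : 'cV[R]_r) :
  x' = x - mv^-1 *: (U^T *m (y + mv *: z + mv *: (U *m Sg *m x))) ->
  y' = y + mv *: z + mv *: (U *m Sg *m x') ->
  U^T *m y' = mv *: ((1%:M - Sg) *m (x - x')).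
Proof.
move=> xE yE.
have UUS q : U^T *m (U *m Sg *m q) = Sg *m q by rewrite !mulmxA UU mul1mx.
have : mv *: x' = mv *: x - U^T *m (y + mv *: z) - mv *: (Sg *m x).
  rewrite {1}xE mulmxDr -scalemxAr UUS scalerBr scalerA mulfV ?gt_eqF // scale1r.
  by rewrite opprD addrA.
have -> : U^T *m y' = U^T *m (y + mv *: z) + mv *: (Sg *m x').
  by rewrite yE mulmxDr -scalemxAr UUS.
rewrite mulmxBl mul1mx mulmxBr.
move: (U^T *m (y + mv *: z)) (Sg *m x) (Sg *m x') => p s s' e.
have -> : p = mv *: x - mv *: s - mv *: x'.
  by rewrite e; apply/matrixP => i j; rewrite !mxE; ring.
by apply/matrixP => i j; rewrite !mxE; ring.
Qed.

(** The energy V of the overview as a function of the three errors, with [W] in the role of D. *)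
Definition lyap (dw : 'cV[R]_n) (dy : 'cV[R]_m) (dx : 'cV[R]_r) : R :=
  dotv dw dw + mw / mv * (dotv dy dy + mv ^+ 2 * dotv dx (W *m dx)).

(** Expanding the square of [dy'] leaves the cross term <dy', U Sigma dx'>, equal to mv <dx', W (dx
    - dx')> by the second hypothesis; polarization in the form [W] then gives the identity. *)
Lemma dual_energy (dy dy' e : 'cV[R]_m) (dx dx' : 'cV[R]_r) :
  dy' = dy + mv *: e + mv *: (U *m Sg *m dx') ->
  U^T *m dy' = mv *: ((1%:M - Sg) *m (dx - dx')) ->
  dotv dy' dy' + mv ^+ 2 * dotv dx' (W *m dx') =
  dotv dy dy + mv ^+ 2 * dotv dx (W *m dx) + 2 * mv * dotv dy e
  + mv ^+ 2 * dotv e e - mv ^+ 2 * dotv (Sg *m dx') (Sg *m dx')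
  - mv ^+ 2 * dotv (dx' - dx) (W *m (dx' - dx)).
Proof.
move=> yE Uy; set s := U *m Sg *m dx' in yE.
have ss : dotv s s = dotv (Sg *m dx') (Sg *m dx').
  by rewrite /s -mulmxA dotv_mull mulmxA UU mul1mx.
have ys : dotv dy' s = mv * (dotv dx' (W *m dx) - dotv dx' (W *m dx')).
  rewrite dotvC /s -mulmxA dotv_mull Uy dotvZr dotv_mull trSg mulmxA -/W.
  by rewrite mulmxBr dotvDr dotvNr.
clearbody s.
have Wsym : dotv dx (W *m dx') = dotv dx' (W *m dx).
  by rewrite dotvC dotv_mull trW.
have -> : dotv (dx' - dx) (W *m (dx' - dx)) =
    dotv dx' (W *m dx') - 2 * dotv dx' (W *m dx) + dotv dx (W *m dx).
  by rewrite mulmxBr !dotv_lin Wsym; ring.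
have yy : dotv dy' dy' = dotv dy' dy + mv * dotv dy' e + mv * dotv dy' s.
  by rewrite {2}yE !dotvDr !dotvZr.
have ye : dotv dy' e = dotv dy e + mv * dotv e e + mv * dotv e s.
  by rewrite yE !dotvDl !dotvZl (dotvC s e).
have yy2 : dotv dy' dy = dotv dy dy + mv * dotv dy e + mv * dotv dy s.
  by rewrite yE !dotvDl !dotvZl (dotvC e dy) (dotvC s dy).
have ys2 : dotv dy' s = dotv dy s + mv * dotv e s + mv * dotv s s.
  by rewrite yE !dotvDl !dotvZl.
rewrite -ss.
have sy : dotv dy s = mv * (dotv dx' (W *m dx) - dotv dx' (W *m dx')) -
    mv * dotv e s - mv * dotv s s by rewrite -ys ys2; ring.
by rewrite yy yy2 ye ys sy; ring.
Qed.

(** Adds the identity [dual_energy], twice the monotonicity of the subgradients at [w'] and [ws],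
    and the gradient estimate [gradE]. The coupling terms in <y - ys, B (w' - ws)> cancel. *)
Lemma lyap_step (w w' ws : 'cV[R]_n) (y y' ys : 'cV[R]_m) (x x' xs : 'cV[R]_r) :
  subgradient f ws (- (G ws + B^T *m ys)) ->
  U^T *m ys = 0 ->
  B *m ws - b + U *m Sg *m xs = 0 ->
  subgradient f w' (mw^-1 *: (w - mw *: G w - mw *: (B^T *m y) - w')) ->
  x' = x - mv^-1 *: (U^T *m (y + mv *: (B *m w' - b) + mv *: (U *m Sg *m x))) ->
  y' = y + mv *: (B *m w' - b) + mv *: (U *m Sg *m x') ->
  lyap (w' - ws) (y' - ys) (x' - xs) + mw * nu * dotv (w - ws) (w - ws)
    + mw * mv * dotv (Sg *m (x' - xs)) (Sg *m (x' - xs))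
  <= lyap (w - ws) (y - ys) (x - xs).
Proof.
move=> sub_s Us fix_s sub_w xE yE.
have Uy := dual_step xE yE.
(* The fixed-point equation expresses [b] through [ws] and [xs], so the errors obey the homogeneous
   update. *)
have dyE : y' - ys = y - ys + mv *: (B *m (w' - ws)) + mv *: (U *m Sg *m (x' - xs)).
  have bE : b = B *m ws + U *m Sg *m xs.
    by apply/eqP; rewrite eq_sym -subr_eq0 addrAC fix_s.
  rewrite yE bE !mulmxBr.
  move: (B *m w') (B *m ws) (_ *m x') (_ *m xs) => e1 e2 e3 e4.
  by apply/matrixP => i j; rewrite !mxE; ring.
have dUy : U^T *m (y' - ys) = mv *: ((1%:M - Sg) *m ((x - xs) - (x' - xs))).
  by rewrite mulmxBr Us subr0 Uy; congr (_ *: (_ *m _)); rewrite opprB addrA subrK.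
have En := dual_energy dyE dUy.
have Wx := W_ge0 ((x' - xs) - (x - xs)).
(* Strong convexity at [w] and [ws] together with the descent inequality from
   [w] to [w']. *)
have gradE : mw * nu * (dotv (w' - ws) (w' - ws) + dotv (w - ws) (w - ws)) <=
    2 * mw * dotv (G w - G ws) (w' - ws) + dotv (w' - w) (w' - w).
  have h1 := Gstr w ws; have h2 := Gstr ws w'; have h3 := descent w' w.
  rewrite !enorm_sqr (dotvC _ (G w)) in h1.
  rewrite !enorm_sqr (dotvC _ (G ws)) -(opprB w' ws) dotvNl !dotvNr opprK in h2.
  have h4 : dotv (G w) (w' - w) = dotv (G w) (w' - ws) - dotv (G w) (w - ws).
    by rewrite -dotvNr -dotvDr opprB addrA subrK.
  have h5 : nu * (dotv (w' - ws) (w' - ws) + dotv (w - ws) (w - ws)) <=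
      2 * dotv (G w - G ws) (w' - ws) + (2 * delta - nu) * dotv (w' - w) (w' - w).
    have -> : dotv (G w - G ws) (w' - ws) = dotv (G w) (w' - ws) - dotv (G ws) (w' - ws).
      by rewrite dotvDl dotvNl.
    lra.
  rewrite -(ler_pM2l mw0) in h5.
  have := ler_wpM2r (dotv_ge0 (w' - w)) mw_le; lra.
have mono0 := subgradient_mono sub_w sub_s.
rewrite -(pmulr_rge0 _ mw0) -dotvZl (scalerBr mw (mw^-1 *: _)) scalerA in mono0.
rewrite mulfV ?gt_eqF // scale1r in mono0.
have mono : 0 <= dotv ((w - ws) - (w' - ws)) (w' - ws) -
    mw * dotv (G w - G ws) (w' - ws) - mw * dotv (y - ys) (B *m (w' - ws)).
  move: mono0.
  have -> : w - mw *: G w - mw *: (B^T *m y) - w' - mw *: - (G ws + B^T *m ys) =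
      ((w - ws) - (w' - ws)) - mw *: (G w - G ws) - mw *: (B^T *m (y - ys)).
    rewrite mulmxBr; move: (G w) (G ws) (_ *m y) (_ *m ys) => g1 g2 e1 e2.
    by apply/matrixP => i j; rewrite !mxE; ring.
  move: (w - ws - (w' - ws)) (w' - ws) (G w - G ws) (y - ys) => p1 p2 p3 p4.
  by rewrite !dotvDl !dotvNl !dotvZl dotv_mull trmxK.
have ww : dotv (w' - w) (w' - w) = dotv ((w - ws) - (w' - ws)) ((w - ws) - (w' - ws)).
  have -> : (w - ws) - (w' - ws) = - (w' - w) by rewrite opprB addrA subrK opprB.
  by rewrite dotvNl dotvNr opprK.
(* This is where the bound on mu_v enters: the term mw mv |B (w' - ws)|^2 of the dual energy is
   absorbed by the term mw nu |w' - ws|^2 of [gradE]. *)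
have Be := ler_wpM2l (ltW mw0) (mv_le (w' - ws)).
have Wxm := mulr_ge0 (mulr_ge0 (ltW mw0) (ltW mv0)) Wx.
rewrite {}ww in gradE; rewrite /lyap En.
move: (w - ws) (w' - ws) => dw dw' in gradE mono Be *.
rewrite dotv_sqrB in gradE; rewrite (dotvDl dw) (dotvNl dw') in mono.
have -> : forall q1 q2 q3 q4 q5 q6 : R,
  mw / mv * (q1 + mv ^+ 2 * q2 + 2 * mv * q3 + mv ^+ 2 * q4 - mv ^+ 2 * q5 - mv ^+ 2 * q6)
  = mw / mv * (q1 + mv ^+ 2 * q2) + 2 * mw * q3 + mw * (mv * q4)
    - mw * mv * q5 - mw * mv * q6.
  by move=> *; field; rewrite gt_eqF.
lra.
Qed.

(** Collects the fixed-point conditions that involve [ys]. The remaining one, [fix_s], concerns [ws]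
    and [xs] alone, so different dual points can share them. *)
Definition dual_fixed (ws : 'cV[R]_n) (ys : 'cV[R]_m) : Prop :=
  subgradient f ws (- (G ws + B^T *m ys)) /\ U^T *m ys = 0.

Context (w : nat -> 'cV[R]_n) (y : nat -> 'cV[R]_m) (x : nat -> 'cV[R]_r).
Context (ws : 'cV[R]_n) (xs : 'cV[R]_r).
Hypothesis wP : forall i, subgradient f (w i.+1)
  (mw^-1 *: (w i - mw *: G (w i) - mw *: (B^T *m y i) - w i.+1)).
Hypothesis xP : forall i, x i.+1 = x i -
  mv^-1 *: (U^T *m (y i + mv *: (B *m w i.+1 - b) + mv *: (U *m Sg *m x i))).
Hypothesis yP : forall i, y i.+1 =
  y i + mv *: (B *m w i.+1 - b) + mv *: (U *m Sg *m x i.+1).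
Hypothesis fix_s : B *m ws - b + U *m Sg *m xs = 0.

Let V ys i := lyap (w i - ws) (y i - ys) (x i - xs).

Lemma lyap_ge dw dy dx :
  dotv dw dw <= lyap dw dy dx /\ mw / mv * dotv dy dy <= lyap dw dy dx.
Proof.
have mm : 0 < mw / mv by rewrite divr_gt0.
have h1 := dotv_ge0 dw; have h2 := mulr_ge0 (ltW mm) (dotv_ge0 dy).
have h3 := mulr_ge0 (ltW mm) (mulr_ge0 (ltW (exprn_gt0 2 mv0)) (W_ge0 dx)).
by rewrite /lyap mulrDr; split; lra.
Qed.

Lemma lyap_ge0 dw dy dx : 0 <= lyap dw dy dx.
Proof. by have [h _] := lyap_ge dw dy dx; exact: le_trans (dotv_ge0 _) h. Qed.

Lemma lyap_decr ys i : dual_fixed ws ys ->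
  V ys i.+1 + mw * nu * dotv (w i - ws) (w i - ws)
    + mw * mv * dotv (Sg *m (x i.+1 - xs)) (Sg *m (x i.+1 - xs)) <= V ys i.
Proof. by move=> [sub_s Us]; exact: lyap_step (wP i) (xP i) (yP i). Qed.

Lemma lyap_le ys i j : dual_fixed ws ys -> (i <= j)%N -> V ys j <= V ys i.
Proof.
move=> fys; move: i j; apply/nonincreasing_seqP => i.
apply: le_trans (lyap_decr i fys); rewrite -addrA lerDl.
by apply: addr_ge0; apply: mulr_ge0; rewrite ?dotv_ge0 // mulr_ge0 // ltW.
Qed.

Lemma primal_cvg ys : dual_fixed ws ys -> w i @[i --> \oo] --> ws.
Proof.
move=> fys; apply: cvg_dotv0.
apply: (@cvg0_of_decrease _ (V ys) _ (mw * nu)); rewrite ?mulr_gt0 //.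
- by move=> i; exact: lyap_ge0.
- by move=> i; exact: dotv_ge0.
move=> i; apply: le_trans (lyap_decr i fys); rewrite lerDl.
by rewrite mulr_ge0 ?dotv_ge0 // mulr_ge0 // ltW.
Qed.

(** The decrease at step i controls Sigma (x_{i+1} - xs), hence the shift; the inverse [T] of Sigma,
    which exists since the lambda_j are positive, removes the factor. *)
Lemma aux_cvg ys : dual_fixed ws ys -> x i @[i --> \oo] --> xs.
Proof.
move=> fys; rewrite -(cvg_shiftS x).
have s0 : Sg *m (x i.+1 - xs) @[i --> \oo] --> (0 : 'cV[R]_r).
  apply: cvg_dotv0; under eq_fun do rewrite subr0.
  apply: (@cvg0_of_decrease _ (V ys) _ (mw * mv)); rewrite ?mulr_gt0 //.
  - by move=> i; exact: lyap_ge0.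
  - by move=> i; exact: dotv_ge0.
  move=> i; apply: le_trans (lyap_decr i fys); rewrite lerD2r lerDl.
  by rewrite mulr_ge0 ?dotv_ge0 // mulr_ge0 // ltW.
pose T := diag_mx (\row_i (lam 0 i)^-1).
have TS (q : 'cV[R]_r) : T *m (Sg *m q) = q.
  apply/matrixP => i j; rewrite !mul_diag_mx !mxE mulrA mulVf ?mul1r //.
  by have /andP[/gt_eqF ->] := lam01 i.
have := @cvg_mulmx _ _ _ T _ _ s0; rewrite mulmx0.
under eq_fun do rewrite TS.
move=> h.
have : x i.+1 - xs + xs @[i --> \oo] --> 0 + xs by apply: cvgD => //; exact: cvg_cst.
by under eq_fun do rewrite subrK; rewrite add0r.
Qed.

Lemma cluster_dual_fixed ys yb : dual_fixed ws ys ->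
  cluster (y i @[i --> \oo]) yb -> dual_fixed ws yb.
Proof.
move=> fys ycl; have [[fs subs] Us] := fys.
have wl := primal_cvg fys; have xl := aux_cvg fys.
have wl1 : w i.+1 @[i --> \oo] --> ws by rewrite (cvg_shiftS w).
have xl1 : x i.+1 @[i --> \oo] --> xs by rewrite (cvg_shiftS x).
split; last first.
  have Uy0 : U^T *m y i @[i --> \oo] --> (0 : 'cV[R]_r).
    rewrite -(cvg_shiftS (fun i => U^T *m y i)).
    have Uyi i : U^T *m y i.+1 = (mv *: (1%:M - Sg)) *m (x i - x i.+1).
      by rewrite (dual_step (xP i) (yP i)) scalemxAl.
    under eq_fun do rewrite Uyi.
    rewrite -(mulmx0 _ (mv *: (1%:M - Sg))); apply: cvg_mulmx.
    by rewrite -(subrr xs); apply: cvgB.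
  apply: dotv_eq0; apply/eqP; rewrite eq_le dotv_ge0 andbT -oppr_ge0.
  apply: (@cluster_ge0 _ _ _ _ (fun z => - dotv (U^T *m z) (U^T *m z))
    (fun i => - dotv (U^T *m y i) (U^T *m y i)) ycl) => //.
    apply: continuousN.
    apply: (@continuous_comp _ _ _ (fun z => U^T *m z) (fun v => dotv v v)).
      exact: mulmx_continuous.
    exact: dotv_continuous.
  by rewrite -oppr0 -(dotv0l (0 : 'cV[R]_r)); apply: cvgN; exact: (cvg_dotv Uy0 Uy0).
split=> // u.
case fu : (f u) => [a| |]; last 2 first.
- by rewrite leey.
- by have := subs u; rewrite fu -(fineK fs).
rewrite -(fineK fs) -EFinD lee_fin dotvNl -subr_ge0.
have -> : a - (fine (f ws) - dotv (G ws + B^T *m yb) (u - ws)) =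
    a - fine (f ws) + dotv (G ws + B^T *m yb) (u - ws) by ring.
pose p i := mw^-1 *: (w i - w i.+1) - (G (w i) - G ws).
(* Adding the subgradient inequality at [w i.+1], tested at [u], to the one at [ws] with dual [ys],
   tested at [w i.+1], eliminates f(w_{i+1}). What remains is the wanted inequality with [y i] in
   place of [yb], up to the error [e i]. *)
pose e i := dotv (p i) (u - w i.+1) + dotv (B *m (w i.+1 - ws)) (y i - ys).
have V0 ys' i : dual_fixed ws ys' -> V ys' i <= V ys' 0%N by move=> h; exact: lyap_le.
have mm : 0 < mw / mv by rewrite divr_gt0.
rewrite dotvDl dotv_mull trmxK addrA dotvC (dotvC yb).
apply: (@cluster_ge0 _ _ _ _ (fun z => a - fine (f ws) + dotv (u - ws) (G ws) +
  dotv (B *m (u - ws)) z) e ycl).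
- apply: continuousD; first exact: cst_continuous.
  exact: dotvl_continuous.
- rewrite -(addr0 (0 : R)); apply: cvgD.
    (* The bound on |u - w_{i+1}|^2 comes from |a - b|^2 <= 2 |a|^2 + 2 |b|^2 and from the energy,
       which never exceeds its initial value. *)
    apply: (@cvg_dotv0_bounded _ _ _ _ (2 * dotv (u - ws) (u - ws) + 2 * V ys 0%N)).
      rewrite -(subr0 (0 : 'cV[R]_n)); apply: cvgB.
        rewrite -(scaler0 _ (mw^-1)); apply: cvgZl_tmp.
        by rewrite -(subrr ws); apply: cvgB.
      rewrite -(subrr (G ws)); apply: cvgB; last exact: cvg_cst.
      apply: cvg_dotv0.
      apply: (@squeeze_cvgr _ _ _ _ (fun=> 0)
        (fun i => delta ^+ 2 * dotv (w i - ws) (w i - ws))).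
      - apply: nearW => i; rewrite dotv_ge0 /= -!enorm_sqr -exprMn.
        by rewrite lerXn2r ?nnegrE ?sqrtr_ge0 ?(le_trans (sqrtr_ge0 _) (Glip _ _)).
      - exact: cvg_cst.
      - rewrite -(mulr0 (delta ^+ 2)); apply: cvgM; first exact: cvg_cst.
        exact: cvg_dotv_sub.
    move=> i.
    have -> : u - w i.+1 = (u - ws) - (w i.+1 - ws) by rewrite opprB addrA subrK.
    have h1 := dotv_ge0 ((u - ws) + (w i.+1 - ws)).
    have h2 := V0 ys i.+1 fys.
    have [h3 _] := lyap_ge (w i.+1 - ws) (y i.+1 - ys) (x i.+1 - xs).
    rewrite -/(V ys i.+1) in h3; move: h1 h3.
    move: (u - ws) (w i.+1 - ws) => v1 v2; rewrite dotv_sqrB !dotv_lin (dotvC v2 v1); lra.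
  apply: (@cvg_dotv0_bounded _ _ _ _ (V ys 0%N / (mw / mv))).
    rewrite -(mulmx0 _ B); apply: cvg_mulmx.
    by rewrite -(subrr ws); apply: cvgB => //; exact: cvg_cst.
  move=> i; rewrite ler_pdivlMr // mulrC.
  by apply: le_trans (V0 ys i fys); exact: (lyap_ge _ _ _).2.
move=> i; have [fi subi] := wP i.
have h1 := subi u; have h2 := subs (w i.+1).
rewrite fu -(fineK fi) -EFinD lee_fin in h1.
rewrite -(fineK fi) -(fineK fs) -EFinD lee_fin in h2.
rewrite /e /p.
have E1 : mw^-1 *: (w i - mw *: G (w i) - mw *: (B^T *m y i) - w i.+1) =
   mw^-1 *: (w i - w i.+1) - (G (w i) - G ws) - (G ws + B^T *m y i).
  move: (B^T *m y i) (G (w i)) (G ws) => c1 c2 c3.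
  by apply/matrixP => j k; rewrite !mxE; field; rewrite gt_eqF.
rewrite {}E1 in h1.
have E2 : u - w i.+1 = (u - ws) - (w i.+1 - ws) by rewrite opprB addrA subrK.
rewrite E2 in h1 *.
rewrite !dotv_mull mulmxBr.
move: (mw^-1 *: _ - _) (B^T *m y i) (B^T *m ys) (u - ws) (w i.+1 - ws) h1 h2.
move=> c1 c2 c3 v1 v2.
rewrite !dotv_lin (dotvC v1 c2) (dotvC v2 c2) (dotvC v2 c3) (dotvC v1 (G ws)).
lra.
Qed.

Lemma dual_cvg ys : dual_fixed ws ys -> exists yb : 'cV[R]_m, y i @[i --> \oo] --> yb.
Proof.
move=> fys.
have mm : 0 < mw / mv by rewrite divr_gt0.
have [] := @ball_compact R m ys (V ys 0%N / (mw / mv)) (fmap y \oo) _.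
  exists 0%N => // i _ /=; rewrite ler_pdivlMr // mulrC.
  by apply: le_trans (lyap_le fys (leq0n i)); exact: (lyap_ge _ _ _).2.
move=> yb [_ ycl]; exists yb.
have fyb := cluster_dual_fixed fys ycl.
have wl := primal_cvg fyb; have xl := aux_cvg fyb.
apply: cvg_dotv0; apply/cvgrPdist_le => e e0.
have e1 : 0 < mw / mv * e / 2 by rewrite divr_gt0 // mulr_gt0.
(* The energy relative to [yb] without its dual term; it tends to 0 by the convergence of [w] and
   [x]. *)
pose rest i := dotv (w i - ws) (w i - ws) +
  mw / mv * (mv ^+ 2 * dotv (x i - xs) (W *m (x i - xs))).
have r0 : rest i @[i --> \oo] --> 0.
  have xl0 : x i - xs @[i --> \oo] --> (0 : 'cV[R]_r).
    by rewrite -(subrr xs); apply: cvgB => //; exact: cvg_cst.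
  have Wl0 : W *m (x i - xs) @[i --> \oo] --> (0 : 'cV[R]_r).
    by rewrite -(mulmx0 _ W); exact: cvg_mulmx.
  have h := cvg_dotv xl0 Wl0; rewrite dotv0l in h.
  have E0 : 0 + mw / mv * (mv ^+ 2 * 0) = 0 :> R by ring.
  rewrite -E0.
  apply: cvgD; first exact: cvg_dotv_sub.
  by apply: cvgM; [exact: cvg_cst|apply: cvgM; [exact: cvg_cst|exact: h]].
have [N _ rN] : \forall i \near \oo,
    `|0 - rest i| < mw / mv * e / 2.
  by move/cvgrPdist_lt: r0; apply.
have nb : nbhs yb [set z | dotv (z - yb) (z - yb) < e / 2].
  have hc : {for yb, continuous (fun z : 'cV[R]_m => dotv (z - yb) (z - yb))}.
    apply: (@continuous_comp _ _ _ (fun z : 'cV[R]_m => z - yb) (fun v => dotv v v)).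
      by apply: continuousB; [exact: cvg_id|exact: cst_continuous].
    exact: dotv_continuous.
  have e2 : 0 < e / 2 by rewrite divr_gt0.
  move/cvgrPdist_lt: hc => /(_ _ e2); apply: filterS => z /=.
  by rewrite subrr dotv0l sub0r normrN ger0_norm ?dotv_ge0.
(* At this index both the dual term and [rest] are below half of (mw / mv) e; monotonicity of the
   energy keeps the bound for all later indices. *)
have [i Ni /= yi] := cluster_nat N ycl nb.
exists i => // j /= ij; rewrite sub0r normrN ger0_norm ?dotv_ge0 //.
rewrite -(ler_pM2l mm).
apply: le_trans (lyap_ge (w j - ws) (y j - yb) (x j - xs)).2 _.
apply: le_trans (lyap_le fyb ij) _; rewrite /V /lyap mulrDr.
have := rN i Ni; rewrite /= sub0r normrN => /(le_lt_trans (ler_norm _)).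
rewrite /rest => hr.
by rewrite -(ltr_pM2l mm) in yi; lra.
Qed.

End Convergence.

(** * Saddle points of the stacked problem *)

Section StackedProblem.
Context {R : realType} {K E : nat}.
Context (C : 'I_E -> {set 'I_K}) (Q : 'I_K -> nat) (S : 'I_E -> nat).
Context (B : forall e k, 'M[R]_(S e, Q k)) (b : forall e, 'I_K -> 'cV[R]_(S e)).
Context (J : forall k, 'cV[R]_(Q k) -> R) (Rg : forall k, 'cV[R]_(Q k) -> \bar R).

Arguments Rg : clear implicits.

Let cJ := stacked_cost J.
Let cR := stacked_reg Rg.
Let cB := stacked_B C B.
Let cb := stacked_b C b.

Lemma objectiveE w : objective J Rg w = (cR w + (cJ w)%:E)%E.
Proof. by rewrite /objective big_split /= sumEFin addeC. Qed.

Lemma lagrangianE w v : lagrangian C B b J Rg w v =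
  (cR w + (cJ w + \sum_(e < E) dotv (v e) (residual C B b w e))%:E)%E.
Proof. by rewrite /lagrangian objectiveE -addeA -EFinD. Qed.

(** In row block (e, i) of [cB] only the column block of agent [i] is nonzero, so summing over the
    agents reassembles constraint e. *)
Lemma sum_fiber_residual w e (s : 'I_(S e)) :
  \sum_i fiber (d := fun e => #|C e|) (cB *m w - cb) s i 0 = residual C B b w e s 0.
Proof.
rewrite /residual summxE (big_enum_val (fun k => (B e k *m submxcol w k - b e k) s 0)).
apply: eq_bigr => i _.
rewrite mxE /cB /stacked_B -{1}[w]submxcolK mxblockEh mul_mxrow_mxcol.
rewrite /cb /stacked_b submxcolB mxcolK submxcol_sum !mxE summxE mxtens_indexK /=.
congr (_ - _).
rewrite (bigD1 (agent i)) //= big1 ?addr0 => [|k ki].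
  rewrite mxcol_mul mxcolK !mxE; apply: eq_bigr => j _.
  by rewrite !mxE mxtens_indexK /= eqxx.
rewrite mxcol_mul mxcolK !mxE big1 // => j _.
by rewrite !mxE mxtens_indexK /= eq_sym (negbTE ki) mul0r.
Qed.

Definition replicate (v : forall e, 'cV[R]_(S e)) : 'cV[R]_(dual_dim C S) :=
  \mxcol_e \col_i v e (mxtens_unindex i).2 0.

Lemma fiber_replicate v e (s : 'I_(S e)) :
  fiber (d := fun e => #|C e|) (replicate v) s = const_mx (v e s 0).
Proof. by apply/matrixP => i j; rewrite mxE [RHS]mxE mxcolK mxE mxtens_indexK. Qed.

Lemma dotv_replicate v w :
  dotv (replicate v) (cB *m w - cb) = \sum_e dotv (v e) (residual C B b w e).
Proof.
rewrite (dotv_fiber (d := fun e => #|C e|)); apply: eq_bigr => e _; rewrite dotvE.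
apply: eq_bigr => s _; rewrite fiber_replicate dotvE -sum_fiber_residual mulr_sumr.
by apply: eq_bigr => i _; rewrite mxE.
Qed.

Hypothesis RgP : forall k,
  [/\ proper_fun (Rg k), closed_fun (Rg k) & convex_efun (Rg k)].

Lemma reg_neqNy k u : Rg k u != -oo%E.
Proof. by have [[]] := RgP k. Qed.

Lemma stacked_reg_neqNy w : cR w != -oo%E.
Proof.
rewrite /cR /stacked_reg esum_eqNy; apply/existsPn => k /=.
exact: reg_neqNy.
Qed.

Lemma stacked_reg_proper : exists w, cR w != +oo%E.
Proof.
have ex k : exists u, Rg k u != +oo%E by have [[]] := RgP k.
pose u k := projT1 (cid (ex k)).
have uP k : Rg k (u k) \is a fin_num.
  by rewrite fin_numE reg_neqNy /= /u; case: cid.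
exists (\mxcol_k u k).
have : cR (\mxcol_k u k) \is a fin_num.
  by apply/sum_fin_numP => k _ _; rewrite mxcolK.
by rewrite fin_numE => /andP[].
Qed.

Lemma stacked_reg_convex : convex_efun cR.
Proof.
move=> w w' t t01; rewrite /cR /stacked_reg.
have d (u : 'cV[R]_(primal_dim Q)) : {in xpredT &, forall i j : 'I_K,
    (Rg i (submxcol u i) +? Rg j (submxcol u j))%E}.
  move=> i j _ _; apply: ltninfty_adde_def; rewrite inE ltNye; exact: reg_neqNy.
rewrite !fin_num_sume_distrr // -big_split /=; apply: lee_sum => k _.
have -> : submxcol (t *: w + (1 - t) *: w') k =
    t *: submxcol w k + (1 - t) *: submxcol w' k.
  by rewrite submxcolD; congr (_ + _); apply/matrixP => i j; rewrite !mxE.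
by have [_ _] := RgP k; apply.
Qed.

(* Provides each [Rg k] with an affine minorant, from which the proximal problem
   has a minimizer block by block. *)
Lemma subgradient_block w g k :
  subgradient cR w g -> subgradient (Rg k) (submxcol w k) (submxcol g k).
Proof.
move=> [fw subw].
have fk j : Rg j (submxcol w j) \is a fin_num.
  by move/sum_fin_numP: fw; apply; rewrite ?mem_index_enum.
split=> // u; pose u' := \mxcol_j eqtype.dfwith (fun j => submxcol w j) u j.
have u'k : submxcol u' k = u by rewrite mxcolK dfwith_in.
have u'j j : j != k -> submxcol u' j = submxcol w j.
  by move=> jk; rewrite mxcolK dfwith_out // eq_sym.
pose s := (\sum_(j < K | j != k) Rg j (submxcol w j))%E.
have sf : s \is a fin_num by apply/sum_fin_numP => j _ _.
have Rw : cR w = (Rg k (submxcol w k) + s)%E by rewrite /cR /stacked_reg (bigD1 k).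
have Ru : cR u' = (Rg k u + s)%E.
  rewrite /cR /stacked_reg (bigD1 k) //= u'k; congr (_ + _)%E.
  by apply: eq_bigr => j jk; rewrite u'j.
have dE : dotv g (u' - w) = dotv (submxcol g k) (u - submxcol w k).
  rewrite dotv_mxcol (bigD1 k) //= submxcolB u'k big1 ?addr0 // => j jk.
  by rewrite submxcolB u'j // subrr dotv0r.
by have := subw u'; rewrite Rw Ru dE addeAC leeD2rE.
Qed.

(** The proximal objective is separable, so blockwise minimizers assemble into a global one; hence
    [xget] returns a true minimizer and Fermat's rule applies, the quadratic being its own
    majorant. *)
Lemma prox_subgradient mu w g x : 0 < mu -> subgradient cR w g ->
  subgradient cR (prox mu cR x) (mu^-1 *: (x - prox mu cR x)).
Proof.
move=> mu0 subw.
pose q (u : 'cV[R]_(primal_dim Q)) := ((2 * mu)^-1 * enorm (x - u) ^+ 2).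
have [k_ kP] : exists u : forall k, 'cV[R]_(Q k), forall k,
    argmin setT (fun v => Rg k v +
      ((2 * mu)^-1 * enorm (submxcol x k - v) ^+ 2)%:E)%E (u k).
  have ne k := argmin_prox_nonempty (submxcol x k) mu0
    (let: And3 _ c _ := RgP k in c) (subgradient_block k subw).
  by exists (fun k => projT1 (cid (ne k))) => k; case: cid.
have qE u : q u = \sum_k (2 * mu)^-1 * enorm (submxcol x k - submxcol u k) ^+ 2.
  rewrite /q enorm_sqr dotv_mxcol mulr_sumr; apply: eq_bigr => k _.
  by rewrite submxcolB enorm_sqr.
have : argmin setT (fun u => cR u + (q u)%:E)%E (prox mu cR x).
  apply: xgetPex; exists (\mxcol_k k_ k); split => // u _.
  rewrite /= -!/(q _) !qE -!sumEFin /cR /stacked_reg -!big_split /=.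
  by apply: lee_sum => k _; rewrite mxcolK; apply: (kP k).2.
move: (prox mu cR x) => p [_ pmin].
rewrite -[_ *: _]opprK.
apply: (@min_subgradient _ _ _ q p _ (2 * mu)^-1).
- exact: stacked_reg_convex.
- exact: stacked_reg_neqNy.
- exact: stacked_reg_proper.
- move=> u; rewrite /q !enorm_sqr.
  have -> : x - u = (x - p) - (u - p) by rewrite opprB addrA subrK.
  rewrite dotv_sqrB dotvNl dotvZl le_eqVlt; apply/orP; left; apply/eqP.
  by field; rewrite gt_eqF.
- by move=> u; exact: pmin.
Qed.

Context (nu c : R).
Hypothesis nu0 : 0 < nu.
Hypothesis Gstr : forall u u',
  cJ u - cJ u' + nu / 2 * enorm (u - u') ^+ 2 <= dotv (u - u') (gradient cJ u).
Hypothesis smooth : forall u u',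
  cJ u <= cJ u' + dotv (gradient cJ u') (u - u') + c * dotv (u - u') (u - u').
Context (w0 : 'cV[R]_(primal_dim Q)) (v0 : forall e, 'cV[R]_(S e)).
Hypothesis saddle : saddle_point (lagrangian C B b J Rg) w0 v0.

(** Fermat's rule for the minimality of [w0] in the Lagrangian at [v0], whose coupling term is a
    pairing with [replicate v0]. *)
Lemma saddle_subgradient :
  subgradient cR w0 (- (gradient cJ w0 + cB^T *m replicate v0)).
Proof.
apply: (@min_subgradient _ _ _
  (fun u => cJ u + dotv (replicate v0) (cB *m u - cb)) w0 _ c).
- exact: stacked_reg_convex.
- exact: stacked_reg_neqNy.
- exact: stacked_reg_proper.
- move=> u; have := smooth u w0.
  rewrite (dotvDl (gradient _ _)) dotv_mull trmxK.
  have -> : cB *m u - cb = (cB *m w0 - cb) + cB *m (u - w0).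
    by rewrite mulmxBr [RHS]addrC addrA subrK.
  by rewrite (dotvDr (_ - cb)); lra.
- move=> u; rewrite !dotv_replicate -!lagrangianE; exact: saddle.2.
Qed.

Lemma saddle_feasible : feasible C B b w0.
Proof.
have [fw0 _] := saddle_subgradient.
(* Moving [v0] in the direction of the residuals raises the Lagrangian by the sum of their squares,
   which maximality of [v0] forces to be at most 0. *)
have := saddle.1 (fun e => v0 e + residual C B b w0 e).
rewrite !lagrangianE leeD2lE // lee_fin lerD2l.
under eq_bigr do rewrite dotvDl.
rewrite big_split /= gerDl => h e; apply: dotv_eq0; apply/eqP.
rewrite eq_le dotv_ge0 andbT; apply: le_trans h.
by rewrite (bigD1 e) //= lerDl sumr_ge0 // => j _; exact: dotv_ge0.
Qed.

(** On feasible points the Lagrangian at [v0] equals the objective, so [w0] is optimal. Uniqueness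
    comes from strong convexity, as the objective at a feasible [u] exceeds its minimum by at least
    (nu / 2) |u - w0|^2. *)
Lemma argmin_saddle : argmin (feasible C B b) (objective J Rg) = [set w0].
Proof.
have [fw0 subw0] := saddle_subgradient.
have sumr w : feasible C B b w -> \sum_(e < E) dotv (v0 e) (residual C B b w e) = 0.
  by move=> fw; rewrite big1 // => e _; rewrite fw dotv0r.
apply/seteqP; split => [u [fu minu]|_ ->]; last first.
  split=> [|u fu]; first exact: saddle_feasible.
  have := saddle.2 u; rewrite !lagrangianE !sumr ?addr0 -?objectiveE //.
  exact: saddle_feasible.
have := minu w0 saddle_feasible; have := subw0 u; rewrite !objectiveE -(fineK fw0).
case: (cR u) => [a| |] //.
rewrite -!EFinD !lee_fin => h1 h2.
have h3 := Gstr w0 u.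
have h4 : dotv (cB^T *m replicate v0) (u - w0) = 0.
  rewrite dotv_mull trmxK.
  have -> : cB *m (u - w0) = (cB *m u - cb) - (cB *m w0 - cb).
    by rewrite mulmxBr opprB addrA subrK.
  rewrite dotvDr dotvNr !dotv_replicate !sumr ?subr0 //; exact: saddle_feasible.
rewrite dotvNl (dotvDl (gradient _ _)) h4 in h1.
rewrite enorm_sqr -(opprB u w0) !dotvNl !dotvNr opprK (dotvC _ (gradient _ _)) in h3.
apply/eqP; rewrite -subr_eq0; apply/eqP; apply: dotv_eq0; apply/eqP.
rewrite eq_le dotv_ge0 andbT -(pmulr_rle0 _ nu0); lra.
Qed.

End StackedProblem.

(** * From the saddle point to the limit of the recursions *)

Theorem theorem1 (R : realType) (K E : nat)
  (adj : rel 'I_K) (C : 'I_E -> {set 'I_K})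
  (Q : 'I_K -> nat) (S : 'I_E -> nat)
  (B : forall e k, 'M[R]_(S e, Q k)) (b : forall e, 'I_K -> 'cV[R]_(S e))
  (J : forall k, 'cV[R]_(Q k) -> R) (Rg : forall k, 'cV[R]_(Q k) -> \bar R)
  (A : forall e, 'M[R]_#|C e|)
  (r : nat) (U1 : 'M[R]_(dual_dim C S, r)) (lam : 'rV[R]_r)
  (delta nu mu_w mu_v : R)
  (w_init : 'cV[R]_(primal_dim Q)) (y_init : 'cV[R]_(dual_dim C S))
  (w : nat -> 'cV[R]_(primal_dim Q)) (y : nat -> 'cV[R]_(dual_dim C S))
  (x : nat -> 'cV[R]_r) :
  let cJ := stacked_cost J in
  let cR := stacked_reg Rg in
  let cB := stacked_B C B in
  let cb := stacked_b C b in
  let Sigma := diag_mx lam in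
  (* constraint sets *)
  (forall e, (0 < #|C e|)%N) ->
  (* cost assumption *)
  0 < nu -> nu <= delta ->
  convex_function setT cJ ->
  (forall u, differentiable (cJ : _ -> R^o) u) ->
  (forall u u', enorm (gradient cJ u - gradient cJ u') <= delta * enorm (u - u')) ->
  (forall u u', cJ u - cJ u' + nu / 2 * enorm (u - u') ^+ 2
                  <= dotv (u - u') (gradient cJ u)) ->
  (forall k, [/\ proper_fun (Rg k), closed_fun (Rg k) & convex_efun (Rg k)]) ->
  (* sub-network assumption *)
  symmetric adj ->
  (forall e, induced_connected adj (C e)) ->
  (* strong duality assumption *)
  (exists w0 v0, saddle_point (lagrangian C B b J Rg) w0 v0) ->
  strong_duality (lagrangian C B b J Rg) ->
  (* combination matrices *)
  (forall e, [/\ (A e)^T = A e, doubly_stochastic (A e) & primitive_mx (A e)]) ->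
  (forall e (s k : 'I_#|C e|),
     agent s \notin neighborhood adj (agent k) -> A e s k = 0) ->
  (* reduced eigendecomposition *)
  U1^T *m U1 = 1%:M ->
  2^-1 *: (1%:M - stacked_A S A) = U1 *m Sigma *m U1^T ->
  (forall i, lam 0 i != 0) ->
  (forall i j : 'I_r, (i <= j)%N -> lam 0 j <= lam 0 i) ->
  (* step-sizes; there is no upper bound on mu_v if lambda_max is 0 *)
  0 < mu_w -> 0 < mu_v ->
  mu_w < (2 * delta - nu)^-1 ->
  (0 < lambda_max (cB^T *m cB) -> mu_v < nu / lambda_max (cB^T *m cB)) ->
  (* recursions *)
  w 0%N = prox mu_w cR
    (w_init - mu_w *: gradient cJ w_init - mu_w *: (cB^T *m y_init)) ->
  y 0%N = y_init + mu_v *: (cB *m w 0%N - cb) ->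
  x 0%N = 0 ->
  (forall i : nat,
     w i.+1 = prox mu_w cR
       (w i - mu_w *: gradient cJ (w i) - mu_w *: (cB^T *m y i))) ->
  (forall i : nat,
     x i.+1 = x i - mu_v^-1 *:
       (U1^T *m (y i + mu_v *: (cB *m w i.+1 - cb)
                 + mu_v *: (U1 *m Sigma *m x i)))) ->
  (forall i : nat,
     y i.+1 = y i + mu_v *: (cB *m w i.+1 - cb)
              + mu_v *: (U1 *m Sigma *m x i.+1)) ->
  (exists l : 'cV[R]_(primal_dim Q) * 'cV[R]_(dual_dim C S) * 'cV[R]_r,
     (w i, y i, x i) @[i --> \oo] --> l) /\
  (exists2 w_opt : 'cV[R]_(primal_dim Q),
     argmin (feasible C B b) (objective J Rg) = [set w_opt] &
     w i @[i --> \oo] --> w_opt).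
Proof.
move=> cJ cR cB cb Sigma _ nu0 nu_le _ _ Glip Gstr RgP _ _ [w0 [v0 saddle]] _.
move=> AP _ UU eigA lam0 _ mw0 mv0 mw_lt mv_lt _ _ _ wE xE yE.
have d0 : 0 < 2 * delta - nu by lra.
have mw_le : mu_w * (2 * delta - nu) <= 1.
  by rewrite -ler_pdivlMr // mul1r ltW.
have mv_le u : mu_v * dotv (cB *m u) (cB *m u) <= nu * dotv u u.
  have uu := dotv_ge0 u.
  have lm := lambda_maxP cB u.
  (* If [lambda_max] is at most 0, then |B u|^2 <= 0 and the inequality holds for every positive
     mu_v. *)
  have [l0|l0] := ltP 0 (lambda_max (cB^T *m cB)); last first.
    have Bu0 : dotv (cB *m u) (cB *m u) <= 0
      by apply: le_trans lm _; rewrite mulr_le0_ge0.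
    by apply: (@le_trans _ _ 0); [rewrite mulr_ge0_le0 // ltW|rewrite mulr_ge0 // ltW].
  have := mv_lt l0; rewrite ltr_pdivlMr // => h.
  have := ler_wpM2r uu (ltW h); have := ler_wpM2l (ltW mv0) lm; lra.
have dsA e : doubly_stochastic (A e) by have [] := AP e.
have prA e : primitive_mx (A e) by have [] := AP e.
have lam01 := lam_bounds dsA prA UU eigA lam0.
have smooth := descent nu0 nu_le Glip Gstr.
have sub0 := saddle_subgradient RgP smooth saddle.
have feas := saddle_feasible RgP smooth saddle.
have Uy0 : U1^T *m replicate C v0 = 0.
  by apply: (consensus_kernel dsA UU eigA lam0) => e s; rewrite fiber_replicate; eexists.
have UUz : U1 *m (U1^T *m (cB *m w0 - cb)) = cB *m w0 - cb.
  apply: (zero_sum_range dsA prA UU eigA) => e s.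
  by rewrite sum_fiber_residual feas mxE.
(* Solves U1 Sigma xs = b - B w0: by [UUz] the right-hand side lies in the range of [U1], and Sigma
   is inverted entrywise. *)
pose xs := - (diag_mx (\row_i (lam 0 i)^-1) *m (U1^T *m (cB *m w0 - cb))).
have fix0 : cB *m w0 - cb + U1 *m Sigma *m xs = 0.
  have -> : U1 *m Sigma *m xs = - (U1 *m (U1^T *m (cB *m w0 - cb))).
    rewrite /xs mulmxN -mulmxA; congr (- (_ *m _)).
    apply/matrixP => i j; rewrite !mul_diag_mx !mxE mulrA mulfV ?mul1r //.
  by rewrite UUz subrr.
have wP i : subgradient cR (w i.+1) (mu_w^-1 *:
    (w i - mu_w *: gradient cJ (w i) - mu_w *: (cB^T *m y i) - w i.+1)).
  by rewrite wE; exact: prox_subgradient mw0 sub0.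
have fixed : dual_fixed cR (gradient cJ) cB U1 w0 (replicate C v0) by [].
have wl : w i @[i --> \oo] --> w0.
  exact: (primal_cvg nu0 nu_le Glip Gstr UU lam01 mw0 mv0
    mw_le mv_le wP xE yE fix0 fixed).
have xl : x i @[i --> \oo] --> xs.
  exact: (aux_cvg nu0 nu_le Glip Gstr UU lam01 mw0 mv0
    mw_le mv_le wP xE yE fix0 fixed).
have [yb yl] := dual_cvg nu0 nu_le Glip Gstr UU lam01 mw0 mv0
  mw_le mv_le wP xE yE fix0 fixed.
split; last by exists w0 => //; exact: (argmin_saddle RgP nu0 Gstr smooth saddle).
exists (w0, yb, xs).
exact: (cvg_pair (cvg_pair wl yl) xl).
Qed.
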